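(* The generators $\delta_n\in\mathcal{H}_1$, $n\ge1$, act on $\mathcal{A}_{G^+(\mathbb{Q})}$ by the formulae $$\delta_n(f\,U_\gamma^* )=\left(\frac{d}{dZ}\right)^n\left(\log\frac{d(Z|_0\gamma)}{dZ}\right)(dZ)^n\,f\,U_\gamma^*,\qquad f\in\mathcal{M},\ \gamma\in G^+(\mathbb{Q}),$$ where modular forms are identified with higher differentials, $f\in\mathcal{M}_k$ standing for $f\cdot(2\pi i\,dz)^{k/2}$. In other words, $\delta_n(fU_\gamma^* )=h_{n,\gamma}fU_\gamma^*$, where $h_{n,\gamma}\in\mathcal{M}_{2n}$ is the modular form with $$h_{n,\gamma}\cdot(2\pi i\,dz)^n=\left(\frac{d}{dZ}\right)^n\left(\log\frac{d(Z|_0\gamma)}{dZ}\right)(dZ)^n.$$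
   Context: $\eta$ is the Dedekind eta function, $\eta^{24}=q\prod_{n\ge1}(1-q^n)^{24}$, $q=e^{2\pi iz}$. On the upper half-plane, $Z(z):=\frac{2\pi i}{6}\int_{i\infty}^z\eta^4\,dz$, so $dZ=\frac{2\pi i}{6}\eta^4dz$ and $\frac{d}{dZ}=\frac{6}{2\pi i\,\eta^4}\frac{d}{dz}$; $Z|_0\gamma(z)=Z(\gamma\cdot z)$ with $\gamma\cdot z=\frac{az+b}{cz+d}$. $G^+(\mathbb{Q})=\mathrm{GL}^+(2,\mathbb{Q})$. For $\alpha=\begin{pmatrix}a&b\\c&d\end{pmatrix}$, $f|_k\alpha(z)=\det(\alpha)^{k/2}f\left(\frac{az+b}{cz+d}\right)(cz+d)^{-k}$; $f|\alpha$ means $k$ is the weight of $f$. $\mathcal{M}=\bigcup_N\bigoplus_{k\ge0}\mathcal{M}_k(\Gamma(N))$ is the algebra of modular forms of all levels (weight $0$: constants), $\mathcal{M}_k$ its weight $k$ part. $\mathcal{A}_{G^+(\mathbb{Q})}=\mathcal{M}\rtimes G^+(\mathbb{Q})$ consists of finite sums $\sum fU_\gamma^*$ with product $fU_\alpha^*\cdot gU_\beta^*=(f\cdot g|\alpha)U_{\beta\alpha}^*$. $\mathcal{H}_1$ is the Hopf algebra which as an algebra is the universal enveloping algebra of the Lie algebra with basis $\{X,Y,\delta_n;n\ge1\}$ and brackets $[Y,X]=X$, $[Y,\delta_n]=n\delta_n$, $[X,\delta_n]=\delta_{n+1}$, $[\delta_k,\delta_\ell]=0$, with multiplicative coproduct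 $\Delta Y=Y\otimes1+1\otimes Y$, $\Delta\delta_1=\delta_1\otimes1+1\otimes\delta_1$, $\Delta X=X\otimes1+1\otimes X+\delta_1\otimes Y$. It acts on $\mathcal{A}_{G^+(\mathbb{Q})}$ by the Hopf action determined by $X(fU_\gamma^* )=X(f)U_\gamma^*$, $Y(fU_\gamma^* )=Y(f)U_\gamma^*$, $\delta_1(fU_\gamma^* )=\mu_\gamma fU_\gamma^*$, where on $\mathcal{M}$: $Y(f)=\frac k2f$ for $f\in\mathcal{M}_k$, $X=\frac1{2\pi i}\frac{d}{dz}-\frac1{2\pi i}\frac{d}{dz}(\log\eta^4)\cdot Y$, and $\mu_\gamma=\frac1{2\pi i}\frac{d}{dz}\log\frac{\eta^4|\gamma}{\eta^4}\in\mathcal{M}_2$ (weight $2$ slash). *)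

(* Defs.v *)
From HB Require Import structures.
From mathcomp Require Import all_boot all_order all_algebra.
From mathcomp Require Import complex finmap.
From mathcomp Require Import monalg.
From mathcomp Require Import all_classical all_reals all_analysis.
From mathcomp Require Import ring lra.

Set Implicit Arguments.
Unset Strict Implicit.
Unset Printing Implicit Defensive.
Import Order.TTheory GRing.Theory Num.Theory.
Import numFieldNormedType.Exports.
Local Open Scope classical_set_scope.
Local Open Scope quotient_scope.
Local Open Scope ring_scope.

(* [presented rel] is the associative unital K-algebra with generators G and
   relations rel: formal expressions modulo the least congruence that contains
   rel and the axioms of K-algebras. *)
Inductive aterm (K G : Type) : Type :=
| TGen of G
| TZero
| TOne
| TAdd of aterm K G & aterm K G
| TMul of aterm K G & aterm K G
| TScale of K & aterm K G.
Arguments TZero {K G}.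
Arguments TOne {K G}.
Arguments TGen {K G}.
HB.instance Definition _ K G := gen_eqMixin (aterm K G).
HB.instance Definition _ K G := gen_choiceMixin (aterm K G).

Section Presented.
Variables (K : comNzRingType) (G : Type).
Variable rel : aterm K G -> aterm K G -> Prop.

Inductive pres_eqv : aterm K G -> aterm K G -> Prop :=
| eqv_rel s t : rel s t -> pres_eqv s t
| eqv_refl s : pres_eqv s s
| eqv_sym s t : pres_eqv s t -> pres_eqv t s
| eqv_trans s t u : pres_eqv s t -> pres_eqv t u -> pres_eqv s u
| eqv_Add s s' t t' :
    pres_eqv s s' -> pres_eqv t t' -> pres_eqv (TAdd s t) (TAdd s' t')
| eqv_Mul s s' t t' :
    pres_eqv s s' -> pres_eqv t t' -> pres_eqv (TMul s t) (TMul s' t')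
| eqv_Scale c s s' : pres_eqv s s' -> pres_eqv (TScale c s) (TScale c s')
| eqv_addA s t u : pres_eqv (TAdd s (TAdd t u)) (TAdd (TAdd s t) u)
| eqv_addC s t : pres_eqv (TAdd s t) (TAdd t s)
| eqv_add0 s : pres_eqv (TAdd TZero s) s
| eqv_addN s : pres_eqv (TAdd (TScale (- 1) s) s) TZero
| eqv_mulA s t u : pres_eqv (TMul s (TMul t u)) (TMul (TMul s t) u)
| eqv_mul1l s : pres_eqv (TMul TOne s) s
| eqv_mul1r s : pres_eqv (TMul s TOne) s
| eqv_mulDl s t u : pres_eqv (TMul (TAdd s t) u) (TAdd (TMul s u) (TMul t u))
| eqv_mulDr s t u : pres_eqv (TMul s (TAdd t u)) (TAdd (TMul s t) (TMul s u))
| eqv_scaleA c d s : pres_eqv (TScale c (TScale d s)) (TScale (c * d) s)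
| eqv_scale1 s : pres_eqv (TScale 1 s) s
| eqv_scaleDr c s t :
    pres_eqv (TScale c (TAdd s t)) (TAdd (TScale c s) (TScale c t))
| eqv_scaleDl c d s :
    pres_eqv (TScale (c + d) s) (TAdd (TScale c s) (TScale d s))
| eqv_scaleAl c s t : pres_eqv (TScale c (TMul s t)) (TMul (TScale c s) t)
| eqv_scaleAr c s t : pres_eqv (TScale c (TMul s t)) (TMul s (TScale c t)).

Definition eqvb s t := `[< pres_eqv s t >].

Lemma eqvb_equiv : equiv_class_of eqvb.
Proof.
split=> [s|s t|t s u]; first by apply/asboolP; exact: eqv_refl.
  by apply/asboolP/asboolP; exact: eqv_sym.
by move=> /asboolP st /asboolP tu; apply/asboolP; exact: eqv_trans st tu.
Qed.
Canonical eqvb_canonical := EquivRelPack eqvb_equiv.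

Definition presented := {eq_quot eqvb}.
HB.instance Definition _ := Choice.on presented.
HB.instance Definition _ := Quotient.on presented.

Local Notation cls := (\pi_presented).

Lemma piP s t : cls s = cls t <-> pres_eqv s t.
Proof. by split => [/eqmodP/asboolP|st] //; apply/eqmodP/asboolP. Qed.

Lemma repr_cls s : pres_eqv (repr (cls s)) s.
Proof. by apply/piP; rewrite reprK. Qed.

(* Locked, so that rewriting with paddE, pmulE and pscaleE does not unfold
   them. *)
Definition padd (x y : presented) : presented :=
  locked (cls (TAdd (repr x) (repr y))).
Definition pmul (x y : presented) : presented :=
  locked (cls (TMul (repr x) (repr y))).
Definition pscale c (x : presented) : presented :=
  locked (cls (TScale c (repr x))).

Lemma paddE s t : padd (cls s) (cls t) = cls (TAdd s t).
Proof. by rewrite /padd -lock; apply/piP/eqv_Add; exact: repr_cls. Qed.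
Lemma pmulE s t : pmul (cls s) (cls t) = cls (TMul s t).
Proof. by rewrite /pmul -lock; apply/piP/eqv_Mul; exact: repr_cls. Qed.
Lemma pscaleE c s : pscale c (cls s) = cls (TScale c s).
Proof. by rewrite /pscale -lock; apply/piP/eqv_Scale; exact: repr_cls. Qed.
Let piE := (paddE, pmulE, pscaleE).

Let paddA : associative padd.
Proof.
elim/quotW => s; elim/quotW => t; elim/quotW => u; rewrite !piE.
apply/piP; exact: eqv_addA.
Qed.
Let paddC : commutative padd.
Proof.
by elim/quotW => s; elim/quotW => t; rewrite !piE; apply/piP; exact: eqv_addC.
Qed.
Let padd0 : left_id (cls TZero) padd.
Proof. by elim/quotW => s; rewrite !piE; apply/piP; exact: eqv_add0. Qed.
Let paddN : left_inverse (cls TZero) (pscale (-1)) padd.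
Proof. by elim/quotW => s; rewrite !piE; apply/piP; exact: eqv_addN. Qed.
HB.instance Definition _ := GRing.isZmodule.Build presented
  paddA paddC padd0 paddN.

Let pmulA : associative pmul.
Proof.
elim/quotW => s; elim/quotW => t; elim/quotW => u; rewrite !piE.
apply/piP; exact: eqv_mulA.
Qed.
Let pmul1l : left_id (cls TOne) pmul.
Proof. by elim/quotW => s; rewrite !piE; apply/piP; exact: eqv_mul1l. Qed.
Let pmul1r : right_id (cls TOne) pmul.
Proof. by elim/quotW => s; rewrite !piE; apply/piP; exact: eqv_mul1r. Qed.
Let pmulDl : left_distributive pmul padd.
Proof.
elim/quotW => s; elim/quotW => t; elim/quotW => u; rewrite !piE.
apply/piP; exact: eqv_mulDl.
Qed.
Let pmulDr : right_distributive pmul padd.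
Proof.
elim/quotW => s; elim/quotW => t; elim/quotW => u; rewrite !piE.
apply/piP; exact: eqv_mulDr.
Qed.
HB.instance Definition _ := GRing.Zmodule_isPzRing.Build presented
  pmulA pmul1l pmul1r pmulDl pmulDr.

Let pscaleA c d x : pscale c (pscale d x) = pscale (c * d) x.
Proof. by elim/quotW: x => s; rewrite !piE; apply/piP; exact: eqv_scaleA. Qed.
Let pscale1 : left_id 1 pscale.
Proof. by elim/quotW => s; rewrite !piE; apply/piP; exact: eqv_scale1. Qed.
Let pscaleDr : right_distributive pscale padd.
Proof.
move=> c; elim/quotW => s; elim/quotW => t; rewrite !piE.
by apply/piP; exact: eqv_scaleDr.
Qed.
Let pscaleDl x c d : pscale (c + d) x = padd (pscale c x) (pscale d x).
Proof. by elim/quotW: x => s; rewrite !piE; apply/piP; exact: eqv_scaleDl. Qed.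
HB.instance Definition _ := GRing.Zmodule_isLmodule.Build K presented
  pscaleA pscale1 pscaleDr pscaleDl.

Lemma presented_scalerAl (c : K) (x y : presented) :
  c *: (x * y) = (c *: x) * y.
Proof.
elim/quotW: x => s; elim/quotW: y => t.
rewrite -[LHS]/(pscale c (pmul _ _)) -[RHS]/(pmul (pscale c _) _) !piE.
by apply/piP; exact: eqv_scaleAl.
Qed.
Lemma presented_scalerAr (c : K) (x y : presented) :
  c *: (x * y) = x * (c *: y).
Proof.
elim/quotW: x => s; elim/quotW: y => t.
rewrite -[LHS]/(pscale c (pmul _ _)) -[RHS]/(pmul _ (pscale c _)) !piE.
by apply/piP; exact: eqv_scaleAr.
Qed.

Definition pgen (g : G) : presented := cls (TGen g).

Section Eval.
Variables (B : algType K) (phi : G -> B).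

Fixpoint teval (t : aterm K G) : B :=
  match t with
  | TGen g => phi g
  | TZero => 0
  | TOne => 1
  | TAdd s t => teval s + teval t
  | TMul s t => teval s * teval t
  | TScale c s => c *: teval s
  end.

Hypothesis phi_rel : forall s t, rel s t -> teval s = teval t.

Lemma eval_eqv s t : pres_eqv s t -> teval s = teval t.
Proof.
elim=> //=.
- by move=> {}s {}t u _ -> _ ->.
- by move=> {}s s' {}t t' _ -> _ ->.
- by move=> {}s s' {}t t' _ -> _ ->.
- by move=> c {}s s' _ ->.
- by move=> *; rewrite addrA.
- by move=> *; rewrite addrC.
- by move=> *; rewrite add0r.
- by move=> *; rewrite scaleN1r addNr.
- by move=> *; rewrite mulrA.
- by move=> *; rewrite mul1r.
- by move=> *; rewrite mulr1.
- by move=> *; rewrite mulrDl.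
- by move=> *; rewrite mulrDr.
- by move=> *; rewrite scalerA.
- by move=> *; rewrite scale1r.
- by move=> *; rewrite scalerDr.
- by move=> *; rewrite scalerDl.
- by move=> *; rewrite scalerAl.
- by move=> *; rewrite scalerAr.
Qed.

Definition pres_lift (x : presented) : B := teval (repr x).

Lemma lift_cls s : pres_lift (cls s) = teval s.
Proof. exact/eval_eqv/repr_cls. Qed.
Lemma lift_gen g : pres_lift (pgen g) = phi g.
Proof. exact: lift_cls. Qed.
Lemma liftD : {morph pres_lift : x y / x + y}.
Proof.
elim/quotW => s; elim/quotW => t.
by rewrite -[_ + _]/(padd _ _) paddE !lift_cls.
Qed.
Lemma liftB : {morph pres_lift : x y / x - y}.
Proof.
elim/quotW => s; elim/quotW => t.
by rewrite -[_ - _]/(padd _ (pscale _ _)) !piE !lift_cls /= scaleN1r.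
Qed.
Lemma liftM : {morph pres_lift : x y / x * y}.
Proof.
elim/quotW => s; elim/quotW => t.
by rewrite -[_ * _]/(pmul _ _) pmulE !lift_cls.
Qed.
Lemma lift1 : pres_lift 1 = 1.
Proof. exact: lift_cls. Qed.
Lemma liftZ c : {morph pres_lift : x / c *: x}.
Proof.
by elim/quotW => s; rewrite -[_ *: _]/(pscale _ _) pscaleE !lift_cls.
Qed.

Lemma presented_neq0 : (1 : presented) != 0.
Proof.
apply/eqP => /(congr1 pres_lift); rewrite lift1 lift_cls => /eqP.
by rewrite oner_eq0.
Qed.
End Eval.
End Presented.

(* Gdelta n is the basis element delta_(n+1). *)
Inductive h1gen := GX | GY | Gdelta of nat.

Section H1.
Variable K : comNzRingType.

Definition tbracket (s t : aterm K h1gen) : aterm K h1gen :=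
  TAdd (TMul s t) (TScale (- 1) (TMul t s)).

(* U(g) is T(g) modulo x y - y x = [x, y]; by bilinearity and antisymmetry it is
   enough to impose this once for every pair of distinct basis elements. *)
Inductive h1_rel : aterm K h1gen -> aterm K h1gen -> Prop :=
| h1_rel_YX : h1_rel (tbracket (TGen GY) (TGen GX)) (TGen GX)
| h1_rel_Yd n : h1_rel (tbracket (TGen GY) (TGen (Gdelta n)))
                       (TScale n.+1%:R (TGen (Gdelta n)))
| h1_rel_Xd n : h1_rel (tbracket (TGen GX) (TGen (Gdelta n)))
                       (TGen (Gdelta n.+1))
| h1_rel_dd k l : h1_rel (tbracket (TGen (Gdelta k)) (TGen (Gdelta l))) TZero.

Definition H1 := presented h1_rel.
HB.instance Definition _ := GRing.PzRing.on H1.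
HB.instance Definition _ := GRing.Lmodule.on H1.

Definition counit_gen (g : h1gen) : K^o := 0.

Lemma counit_rel s t : h1_rel s t -> teval counit_gen s = teval counit_gen t.
Proof. by case=> *; rewrite /= ?mul0r ?scaler0 ?addr0. Qed.

HB.instance Definition _ := GRing.PzSemiRing_isNonZero.Build H1
  (presented_neq0 counit_rel).
HB.instance Definition _ := GRing.Lmodule_isLalgebra.Build K H1
  (@presented_scalerAl _ _ h1_rel).
HB.instance Definition _ := GRing.Lalgebra_isAlgebra.Build K H1
  (@presented_scalerAr _ _ h1_rel).

Definition hX : H1 := pgen h1_rel GX.
Definition hY : H1 := pgen h1_rel GY.
(* delta_n, meaningful for n >= 1 only. *)
Definition hdelta (n : nat) : H1 := pgen h1_rel (Gdelta n.-1).

Definition counit : H1 -> K := pres_lift counit_gen.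

Section Tensor.
Variables A B : algType K.
Local Notation pair a b := (TGen (a, b)).
(* The algebra A (x) B: by tensor_rel_M and tensor_rel_1 every expression is a
   linear combination of pure tensors, and the remaining relations are those of
   the tensor product of modules. *)
Inductive tensor_rel : aterm K (A * B) -> aterm K (A * B) -> Prop :=
| tensor_rel_Dl a a' b :
    tensor_rel (pair (a + a') b) (TAdd (pair a b) (pair a' b))
| tensor_rel_Dr a b b' :
    tensor_rel (pair a (b + b')) (TAdd (pair a b) (pair a b'))
| tensor_rel_Zl c a b : tensor_rel (pair (c *: a) b) (TScale c (pair a b))
| tensor_rel_Zr c a b : tensor_rel (pair a (c *: b)) (TScale c (pair a b))
| tensor_rel_M a a' b b' :
    tensor_rel (TMul (pair a b) (pair a' b')) (pair (a * a') (b * b'))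
| tensor_rel_1 : tensor_rel (pair 1 1) TOne.
End Tensor.

Definition H1H1 := presented (@tensor_rel H1 H1).
HB.instance Definition _ := GRing.PzRing.on H1H1.
HB.instance Definition _ := GRing.Lmodule.on H1H1.

Definition counit2_gen (g : H1 * H1) : K^o := counit g.1 * counit g.2.

Lemma counit2_rel s t :
  tensor_rel s t -> teval counit2_gen s = teval counit2_gen t.
Proof.
case=> *; rewrite /= /counit2_gen /= /counit.
- by rewrite (liftD counit_rel) mulrDl.
- by rewrite (liftD counit_rel) mulrDr.
- by rewrite (liftZ counit_rel); exact/esym/mulrA.
- by rewrite (liftZ counit_rel); exact: mulrCA.
- by rewrite !(liftM counit_rel) mulrACA.
- by rewrite (lift1 counit_rel) mulr1.
Qed.

HB.instance Definition _ := GRing.PzSemiRing_isNonZero.Build H1H1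
  (presented_neq0 counit2_rel).
HB.instance Definition _ := GRing.Lmodule_isLalgebra.Build K H1H1
  (@presented_scalerAl _ _ (@tensor_rel H1 H1)).
HB.instance Definition _ := GRing.Lalgebra_isAlgebra.Build K H1H1
  (@presented_scalerAr _ _ (@tensor_rel H1 H1)).

Definition tens (a b : H1) : H1H1 := pgen (@tensor_rel H1 H1) (a, b).

Lemma tensDl a a' b : tens (a + a') b = tens a b + tens a' b.
Proof. by rewrite -[RHS]/(padd _ _) paddE; apply/piP/eqv_rel; constructor. Qed.
Lemma tensDr a b b' : tens a (b + b') = tens a b + tens a b'.
Proof. by rewrite -[RHS]/(padd _ _) paddE; apply/piP/eqv_rel; constructor. Qed.
Lemma tensZl c a b : tens (c *: a) b = c *: tens a b.
Proof.
by rewrite -[RHS]/(pscale _ _) pscaleE; apply/piP/eqv_rel; constructor.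
Qed.
Lemma tensZr c a b : tens a (c *: b) = c *: tens a b.
Proof.
by rewrite -[RHS]/(pscale _ _) pscaleE; apply/piP/eqv_rel; constructor.
Qed.
Lemma tensM a a' b b' : tens a b * tens a' b' = tens (a * a') (b * b').
Proof. by rewrite -[LHS]/(pmul _ _) pmulE; apply/piP/eqv_rel; constructor. Qed.
Lemma tens11 : tens 1 1 = 1.
Proof. by apply/piP/eqv_rel; constructor. Qed.
Lemma tens0l b : tens 0 b = 0.
Proof. by rewrite -(scale0r 0) tensZl scale0r. Qed.
Lemma tens0r a : tens a 0 = 0.
Proof. by rewrite -(scale0r 0) tensZr scale0r. Qed.
Lemma tensBl a a' b : tens (a - a') b = tens a b - tens a' b.
Proof. by rewrite tensDl -scaleN1r tensZl scaleN1r. Qed.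
Lemma tensBr a b b' : tens a (b - b') = tens a b - tens a b'.
Proof. by rewrite tensDr -scaleN1r tensZr scaleN1r. Qed.

Definition lie (A : pzRingType) (a b : A) : A := a * b - b * a.

Lemma tbracketE s t : \pi_H1 (tbracket s t) = lie (\pi_H1 s) (\pi_H1 t).
Proof.
rewrite /lie -scaleN1r -[RHS]/(padd (pmul _ _) (pscale _ (pmul _ _))).
by rewrite !pmulE pscaleE paddE.
Qed.

Lemma br_YX : lie hY hX = hX.
Proof. by rewrite -tbracketE; apply/piP/eqv_rel; constructor. Qed.
Lemma br_Yd n : lie hY (hdelta n.+1) = n.+1%:R *: hdelta n.+1.
Proof.
rewrite -tbracketE -[RHS]/(pscale _ _) pscaleE.
by apply/piP/eqv_rel; constructor.
Qed.
Lemma br_Xd n : lie hX (hdelta n.+1) = hdelta n.+2.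
Proof. by rewrite -tbracketE; apply/piP/eqv_rel; constructor. Qed.
Lemma br_dd k l : lie (hdelta k) (hdelta l) = 0.
Proof. by rewrite -tbracketE; apply/piP/eqv_rel; constructor. Qed.

(* Values of the coproduct on the generators; the value on delta_(n+1) is forced
   by delta_(n+1) = [X, delta_n]. *)
Definition Delta_X : H1H1 := tens hX 1 + tens 1 hX + tens (hdelta 1) hY.
Definition Delta_Y : H1H1 := tens hY 1 + tens 1 hY.
Fixpoint Delta_delta (n : nat) : H1H1 :=
  if n is n'.+1 then lie Delta_X (Delta_delta n')
  else tens (hdelta 1) 1 + tens 1 (hdelta 1).

Definition Delta_gen (g : h1gen) : H1H1 :=
  match g with GX => Delta_X | GY => Delta_Y | Gdelta n => Delta_delta n end.

Section Bracket.
Variable A : algType K.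
Implicit Types a b c : A.
Lemma brDl a b c : lie (a + b) c = lie a c + lie b c.
Proof. by rewrite /lie mulrDl mulrDr opprD addrACA. Qed.
Lemma brDr a b c : lie a (b + c) = lie a b + lie a c.
Proof. by rewrite /lie mulrDl mulrDr opprD addrACA. Qed.
Lemma brZr k a b : lie a (k *: b) = k *: lie a b.
Proof. by rewrite /lie -scalerAl -scalerAr scalerBr. Qed.
Lemma brMr a b c : lie a (b * c) = lie a b * c + b * lie a c.
Proof. by rewrite /lie mulrBl mulrBr !mulrA addrA subrK. Qed.
Lemma br_jacobi a b c : lie a (lie b c) = lie (lie a b) c + lie b (lie a c).
Proof.
have brNr (u v : A) : lie u (- v) = - lie u v.
  by rewrite -(scaleN1r v) brZr scaleN1r.
rewrite {2}/lie brDr brNr !brMr opprD [X in _ + X]addrC addrACA.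
by rewrite -[lie a b * c - _]/(lie _ _).
Qed.
Lemma brrr a : lie a a = 0. Proof. exact: subrr. Qed.
Lemma br1 a : lie a 1 = 0.
Proof. by rewrite /lie mulr1 mul1r subrr. Qed.
End Bracket.

Lemma br_tensl a c d : lie (tens a 1) (tens c d) = tens (lie a c) d.
Proof. by rewrite /lie !tensM mulr1 mul1r tensBl. Qed.
Lemma br_tensr b c d : lie (tens 1 b) (tens c d) = tens c (lie b d).
Proof. by rewrite /lie !tensM mulr1 mul1r tensBr. Qed.

(* The elements Delta_delta n lie in K[delta] (x) K[delta], which is commutative
   and stable under bracket with Delta_X: hence they commute. *)
Inductive delta_alg : H1 -> Prop :=
| delta_alg_gen n : delta_alg (hdelta n.+1)
| delta_alg1 : delta_alg 1
| delta_alg0 : delta_alg 0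
| delta_algD a b : delta_alg a -> delta_alg b -> delta_alg (a + b)
| delta_algZ k a : delta_alg a -> delta_alg (k *: a)
| delta_algM a b : delta_alg a -> delta_alg b -> delta_alg (a * b).

Lemma delta_alg_comm a b : delta_alg a -> delta_alg b -> a * b = b * a.
Proof.
move=> da db; elim: da => [n||| a1 a2 _ IH1 _ IH2|k a1 _ IH|a1 a2 _ IH1 _ IH2].
- elim: db => [m||| b1 b2 _ IH1 _ IH2|k b1 _ IH|b1 b2 _ IH1 _ IH2].
  + by apply/eqP; rewrite -subr_eq0; apply/eqP/br_dd.
  + by rewrite mulr1 mul1r.
  + by rewrite mulr0 mul0r.
  + by rewrite mulrDr mulrDl IH1 IH2.
  + by rewrite -scalerAr -scalerAl IH.
  + by rewrite mulrA IH1 -mulrA IH2 mulrA.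
- by rewrite mulr1 mul1r.
- by rewrite mulr0 mul0r.
- by rewrite mulrDr mulrDl IH1 IH2.
- by rewrite -scalerAr -scalerAl IH.
- by rewrite -mulrA IH2 mulrA IH1 mulrA.
Qed.

Lemma delta_alg_brX a : delta_alg a -> delta_alg (lie hX a).
Proof.
elim=> [n||| a1 a2 d1 IH1 d2 IH2|k a1 _ IH|a1 a2 d1 IH1 d2 IH2].
- by rewrite br_Xd; constructor.
- by rewrite br1; constructor.
- by rewrite /lie mulr0 mul0r subrr; constructor.
- by rewrite brDr; constructor.
- by rewrite brZr; constructor.
- by rewrite brMr; apply: delta_algD; apply: delta_algM.
Qed.

Lemma delta_alg_brY a : delta_alg a -> delta_alg (lie hY a).
Proof.
elim=> [n||| a1 a2 d1 IH1 d2 IH2|k a1 _ IH|a1 a2 d1 IH1 d2 IH2].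
- by rewrite br_Yd; do 2!constructor.
- by rewrite br1; constructor.
- by rewrite /lie mulr0 mul0r subrr; constructor.
- by rewrite brDr; constructor.
- by rewrite brZr; constructor.
- by rewrite brMr; apply: delta_algD; apply: delta_algM.
Qed.

Inductive delta_tens : H1H1 -> Prop :=
| delta_tens_gen a b : delta_alg a -> delta_alg b -> delta_tens (tens a b)
| delta_tensD u v : delta_tens u -> delta_tens v -> delta_tens (u + v).

Lemma delta_tens_comm u v : delta_tens u -> delta_tens v -> lie u v = 0.
Proof.
move=> du dv; rewrite /lie; apply/eqP; rewrite subr_eq0; apply/eqP.
elim: du => [a b da db|u1 u2 _ IH1 _ IH2].
  elim: dv => [a' b' da' db'|v1 v2 _ IH1 _ IH2].
    by rewrite !tensM (delta_alg_comm da da') (delta_alg_comm db db').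
  by rewrite mulrDr mulrDl IH1 IH2.
by rewrite mulrDr mulrDl IH1 IH2.
Qed.

Lemma delta_tens_br u : delta_tens u -> delta_tens (lie Delta_X u).
Proof.
elim=> [a b da db|u1 u2 _ IH1 _ IH2]; last by rewrite brDr; constructor.
rewrite !brDl; apply: delta_tensD; first apply: delta_tensD.
- rewrite br_tensl; apply: delta_tens_gen => //.
  exact: delta_alg_brX.
- rewrite br_tensr; apply: delta_tens_gen => //.
  exact: delta_alg_brX.
rewrite /lie !tensM (delta_alg_comm da (delta_alg_gen 0)) -tensBr.
apply: delta_tens_gen; last exact: delta_alg_brY.
by apply: delta_algM => //; exact: delta_alg_gen.
Qed.

Lemma Delta_delta_tens n : delta_tens (Delta_delta n).
Proof.
elim: n => [|n /delta_tens_br //]; apply: delta_tensD; apply: delta_tens_gen;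
  by [exact: delta_alg_gen|exact: delta_alg1].
Qed.

Lemma br_DYX : lie Delta_Y Delta_X = Delta_X.
Proof.
rewrite brDl !brDr !br_tensl !br_tensr br_YX br_Yd scale1r brrr !br1.
by rewrite !tens0r !tens0l !addr0 !add0r addrAC.
Qed.

Lemma br_DYd n : lie Delta_Y (Delta_delta n) = n.+1%:R *: Delta_delta n.
Proof.
elim: n => [|n IH] /=.
  rewrite brDl !brDr !br_tensl !br_tensr br_Yd !scale1r !br1.
  by rewrite !tens0r !tens0l addr0 add0r.
by rewrite br_jacobi br_DYX IH brZr -[X in X + _]scale1r -scalerDl nat1r.
Qed.

Lemma Delta_rel s t : h1_rel s t -> teval Delta_gen s = teval Delta_gen t.
Proof.
case=> [|n|n|k l]; rewrite /= scaleN1r.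
- exact: br_DYX.
- exact: br_DYd.
- by [].
- by apply: delta_tens_comm; exact: Delta_delta_tens.
Qed.

Definition Delta : H1 -> H1H1 := pres_lift Delta_gen.

Lemma Delta_additive : additive Delta.
Proof. exact: liftB Delta_rel. Qed.
HB.instance Definition _ := GRing.isAdditive.Build H1 H1H1 Delta Delta_additive.
Lemma Delta_multiplicative : multiplicative Delta.
Proof. by split; [exact: liftM Delta_rel|exact: lift1 Delta_rel]. Qed.
HB.instance Definition _ := GRing.isMultiplicative.Build H1 H1H1 Delta
  Delta_multiplicative.
Lemma Delta_scalable : scalable Delta.
Proof. exact: liftZ Delta_rel. Qed.
HB.instance Definition _ := GRing.isScalable.Build K H1 H1H1 *:%R Delta
  Delta_scalable.

Lemma Delta_hX : Delta hX = tens hX 1 + tens 1 hX + tens (hdelta 1) hY.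
Proof. exact: (lift_gen Delta_rel). Qed.
Lemma Delta_hY : Delta hY = tens hY 1 + tens 1 hY.
Proof. exact: (lift_gen Delta_rel). Qed.
Lemma Delta_hdelta1 : Delta (hdelta 1) = tens (hdelta 1) 1 + tens 1 (hdelta 1).
Proof. exact: (lift_gen Delta_rel). Qed.
End H1.

Record GL2pQ := GL2p { gmx :> 'M[rat]_2; gmxP : 0 < \det gmx }.
HB.instance Definition _ := [isSub for gmx].
HB.instance Definition _ := [Choice of GL2pQ by <:].

Lemma gmul_subproof (a b : GL2pQ) : 0 < \det (a *m b).
Proof. by rewrite det_mulmx mulr_gt0 ?gmxP. Qed.
Definition gmul (a b : GL2pQ) : GL2pQ := GL2p (gmul_subproof a b).

Lemma gone_subproof : 0 < \det (1%:M : 'M[rat]_2).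
Proof. by rewrite det1. Qed.
Definition gone : GL2pQ := GL2p gone_subproof.

(* Gamma(N), as a subset of GL2+(Q); Gamma 1 is SL2(Z). *)
Definition Gamma (N : nat) (g : GL2pQ) : Prop :=
  exists m : 'M[int]_2, [/\ gmx g = map_mx intr m, \det m = 1 &
    forall i j, (m i j = (1%:M : 'M[int]_2) i j %[mod N])%Z].

Section UpperHalfPlane.
Variable R : realType.

(* The complex numbers, packaged so as to carry the topology and the norm that
   the library attaches to a numFieldType. *)
Definition Cx : numFieldType := R[i].
Local Notation C := Cx.

Record uhp := Uhp { uhp_val :> C; uhpP : 0 < complex.Im uhp_val }.
HB.instance Definition _ := [isSub for uhp_val].
HB.instance Definition _ := [Choice of uhp by <:].

HB.instance Definition _ := isPointed.Build uhp (@Uhp (Complex 0 1) ltr01).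

Local Notation hfun := (uhp -> C).

(* Functions on the upper half-plane are extended by 0 in order to be
   differentiated. *)
Definition extend (f : hfun) (w : C) : C :=
  if insub w is Some z then f z else 0.

Definition ddz (f : hfun) : hfun := fun z => 'D_1 (extend f) (uhp_val z).

Definition holomorphic (f : hfun) :=
  forall z : uhp, derivable (extend f) (uhp_val z) 1.

Definition gnum (g : GL2pQ) (z : C) : C := ratr (g 0 0) * z + ratr (g 0 1).
Definition gden (g : GL2pQ) (z : C) : C := ratr (g 1 0) * z + ratr (g 1 1).

Lemma ratCE (q : rat) : (ratr q : C) = Complex (ratr q : R) 0.
Proof.
by rewrite -[LHS](fmorph_rat (real_complex R : {rmorphism R -> R[i]})).
Qed.

Lemma det_mx2 (T : comNzRingType) (m : 'M[T]_2) :
  \det m = m 0 0 * m 1 1 - m 0 1 * m 1 0.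
Proof.
rewrite (expand_det_row _ 0) big_ord_recl big_ord1 /cofactor !det_mx11 !mxE /=.
rewrite expr0 expr1 mul1r mulN1r mulrN.
by congr (m _ _ * m _ _ - m _ _ * m _ _); apply/val_inj.
Qed.

Lemma gden_neq0 g (z : uhp) : gden g z != 0.
Proof.
apply/eqP; rewrite /gden !ratCE; case: z => -[x y] /= y_gt0 [].
rewrite !mul0r !addr0 subr0 => e1 /eqP.
rewrite mulf_eq0 (gt_eqF y_gt0) orbF fmorph_eq0 => /eqP c0.
move: e1; rewrite c0 rmorph0 mul0r add0r => /eqP; rewrite fmorph_eq0 => /eqP d0.
by have := gmxP g; rewrite det_mx2 c0 d0 !mulr0 subr0 ltxx.
Qed.

Lemma Im_mobius g (z : uhp) :
  0 < complex.Im (gnum g z / gden g z : R[i]).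
Proof.
have := gden_neq0 g z; have := gmxP g; rewrite det_mx2.
rewrite /gnum /gden !ratCE; case: z => -[x y] /= y_gt0.
rewrite -(ltr0q R) rmorphB !rmorphM /=.
set a := ratr (g 0 0); set b := ratr (g 0 1).
set c := ratr (g 1 0); set d := ratr (g 1 1) => D.
rewrite ?mul0r ?addr0 ?subr0 => nz.
set s := (X in _ / X); have s_gt0 : 0 < s.
  rewrite lt_neqAle addr_ge0 ?sqr_ge0// andbT eq_sym; apply: contraNneq nz.
  rewrite /s => /eqP; rewrite paddr_eq0 ?sqr_ge0// !sqrf_eq0.
  move=> /andP[/eqP h1 /eqP h2].
  have -> : (Complex c 0 * Complex x y + Complex d 0 : R[i]) =
      Complex (c * x + d) (c * y).
    by apply/eqP; rewrite eq_complex /= !(mul0r, addr0, subr0) !eqxx.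
  by rewrite h1 h2.
suff -> : (a * x + b) * - (c * y / s) + a * y * ((c * x + d) / s) =
  (a * d - b * c) * y / s by rewrite divr_gt0 ?mulr_gt0.
by move: (s) s_gt0 => t t_gt0; field; rewrite gt_eqF.
Qed.

Definition mobius (g : GL2pQ) (z : uhp) : uhp := Uhp (Im_mobius g z).

Definition slash (k : nat) (g : GL2pQ) (f : hfun) : hfun := fun z =>
  (ratr (\det g) `^ (k%:R / 2))%:C%C * f (mobius g z) * (gden g z ^+ k)^-1.

(* The last clause is holomorphy at the cusps: every f|g, g in SL2(Z), is
   bounded on some half-plane Im z >= A. *)
Definition modular (N k : nat) (f : hfun) := [/\ holomorphic f,
  forall g, Gamma N g -> slash k g f = f &
  forall g, Gamma 1 g -> exists A B : R, forall z : uhp,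
    A <= complex.Im (uhp_val z) -> `|slash k g f z| <= B%:C%C].

End UpperHalfPlane.

Section ModularForms.
Variable R : realType.
Local Notation C := (Cx R).
Local Notation uhp := (uhp R).
Local Notation hfun := (uhp -> C).

Lemma extendE (f : hfun) (z : uhp) : extend f (uhp_val z) = f z.
Proof. by rewrite /extend (valK z). Qed.

Lemma near_uhp (z : uhp) : \forall w \near uhp_val z, 0 < complex.Im (w : R[i]).
Proof.
apply/nbhs_ballP; exists (complex.Im (uhp_val z))%:C%C => /=.
  by rewrite ltcR uhpP.
move=> w; rewrite -ball_normE /ball_ /= => zw.
have : `|complex.Im (uhp_val z - w : R[i])|%:C%C <
    (complex.Im (uhp_val z))%:C%C.
  apply: le_lt_trans zw; rewrite [X in _ <= X]normc_def lecR.
  by rewrite -sqrtr_sqr ler_wsqrtr// lerDr sqr_ge0.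
rewrite ltcR; case: (uhp_val z) w {zw} => [x y] [u v] /=.
by move=> /(le_lt_trans (ler_norm _)); lra.
Qed.

Lemma derivable_extend (f : hfun) (F : C -> C) (z : uhp) :
    (forall w : uhp, f w = F (uhp_val w)) ->
  derivable (extend f) (uhp_val z) 1 <-> derivable F (uhp_val z) 1.
Proof.
move=> fF; have eqn : \forall w \near uhp_val z, extend f w = F w.
  near=> w; have wP : 0 < complex.Im (w : R[i]) by near: w; exact: near_uhp.
  by transitivity (f (Uhp wP)); [rewrite -extendE|exact: fF].
split; apply: near_eq_derivable => //.
by move: eqn; apply: filterS => w.
Unshelve. all: end_near. Qed.

Lemma holomorphic_cst (c : C) : holomorphic (cst c : hfun).
Proof. by move=> z; apply/(derivable_extend z (F := cst c)) => //. Qed.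

Lemma holomorphicB (f g : hfun) :
  holomorphic f -> holomorphic g -> holomorphic (f - g).
Proof.
move=> hf hg z; apply/(derivable_extend z (F := extend f - extend g)).
  by move=> w /=; rewrite !fctE !extendE.
exact: derivableB.
Qed.

Lemma holomorphicM (f g : hfun) :
  holomorphic f -> holomorphic g -> holomorphic (f * g).
Proof.
move=> hf hg z; apply/(derivable_extend z (F := extend f * extend g)).
  by move=> w /=; rewrite !fctE !extendE.
exact: derivableM.
Qed.

Lemma differentiable_affine (a b z : C) :
  differentiable (fun w : C => a * w + b) z.
Proof.
apply/derivable1_diffP.
exact: (@derivableD _ _ _ (cst a * id) (cst b)).
Qed.

Lemma holomorphic_slash k g (f : hfun) :
  holomorphic f -> holomorphic (slash k g f).
Proof.
move=> hf z.
pose F : C -> C := cst (ratr (\det g) `^ (k%:R / 2))%:C%C *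
  (extend f \o (fun w => gnum g w / gden g w)) *
  (fun w => (gden g w ^+ k)^-1).
apply/(derivable_extend z (F := F)).
  move=> w; rewrite /F !fctE /= -[gnum g _ / _]/(uhp_val (mobius g w)).
  by rewrite extendE.
have dgden : differentiable (gden (R := R) g) (uhp_val z).
  exact: differentiable_affine.
have dgnum : differentiable (gnum (R := R) g) (uhp_val z).
  exact: differentiable_affine.
have dV : differentiable (fun w => (gden (R := R) g w)^-1) (uhp_val z).
  by apply: differentiableV => //; exact: gden_neq0.
apply: derivableM; last first.
  have -> : (fun w => (gden (R := R) g w ^+ k)^-1) =
      (fun w => (gden (R := R) g w)^-1) ^+ k.
    by apply/funext => w; rewrite fctE exprVn.
  by apply/derivableX/derivable1_diffP.
apply: derivableM => //.
apply/derivable1_diffP/differentiable_comp.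
  exact: (differentiableM dgnum dV).
by apply/derivable1_diffP; exact: (hf (mobius g z)).
Qed.

Lemma gmulE (a b : GL2pQ) i j : gmul a b i j = a i 0 * b 0 j + a i 1 * b 1 j.
Proof.
rewrite [LHS]mxE big_ord_recl big_ord1.
by congr (_ * _ + a i _ * b _ j); apply/val_inj.
Qed.

Lemma mul_affine (p q r s t u w : C) :
  (p * r + q * s) * w + (p * t + q * u) = p * (r * w + t) + q * (s * w + u).
Proof. by ring. Qed.

Lemma gden_gmul a b (z : uhp) :
  gden (gmul a b) z = gden a (mobius b z) * gden b z :> C.
Proof.
rewrite [LHS]/gden !gmulE !rmorphD !rmorphM {1}/gden.
have -> : uhp_val (mobius b z) = gnum b z / gden b z by [].
by rewrite [RHS]mulrDl -[X in _ = X + _]mulrA divfK ?gden_neq0// mul_affine.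
Qed.

Lemma gnum_gmul a b (z : uhp) :
  gnum (gmul a b) z = gnum a (mobius b z) * gden b z :> C.
Proof.
rewrite [LHS]/gnum !gmulE !rmorphD !rmorphM {1}/gnum.
have -> : uhp_val (mobius b z) = gnum b z / gden b z by [].
by rewrite [RHS]mulrDl -[X in _ = X + _]mulrA divfK ?gden_neq0// mul_affine.
Qed.

Lemma mobius_gmul a b (z : uhp) : mobius (gmul a b) z = mobius a (mobius b z).
Proof.
apply/val_inj => /=; rewrite -/(uhp_val (mobius b z)) gnum_gmul gden_gmul.
by rewrite -mulf_div divff ?mulr1// gden_neq0.
Qed.

Lemma slash_gmul k a b (f : hfun) :
  slash k b (slash k a f) = slash k (gmul a b) f.
Proof.
apply/funext => z; rewrite /slash mobius_gmul gden_gmul.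
rewrite -[gmx (gmul a b)]/(gmx a *m gmx b) det_mulmx.
have -> : ratr (\det a * \det b) `^ (k%:R / 2) =
    ratr (\det a) `^ (k%:R / 2) * ratr (\det b) `^ (k%:R / 2) :> R.
  by rewrite rmorphM powRM// ler0q ltW ?gmxP.
rewrite -[(_ * _)%:C%C]/(real_complex R _) (rmorphM (real_complex R)).
by rewrite exprMn invfM [X in _ = X * _ * _]mulrC !mulrA mulrAC.
Qed.

Lemma Gamma_dvd N N' g : (N %| N')%N -> Gamma N' g -> Gamma N g.
Proof.
move=> NN' [m [gm m1 mN]]; exists m; split=> // i j.
apply/eqP; rewrite eqz_mod_dvd (dvdz_trans _ (_ : (N' %| _)%Z)) //.
by rewrite -eqz_mod_dvd mN.
Qed.

Lemma slash0 g (c : C) : slash 0 g (cst c : hfun) = cst c.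
Proof.
by apply/funext => z; rewrite /slash mul0r powRr0 expr0 invr1 mulr1 mul1r.
Qed.

Lemma slashB k g (f1 f2 : hfun) :
  slash k g (f1 - f2) = slash k g f1 - slash k g f2.
Proof. by apply/funext => z; rewrite /slash !fctE mulrBr mulrBl. Qed.

Lemma slashM k l g (f1 f2 : hfun) :
  slash (k + l) g (f1 * f2) = slash k g f1 * slash l g f2.
Proof.
apply/funext => z; rewrite /slash !fctE natrD mulrDl powRD; last first.
  by apply/implyP => _; rewrite gt_eqF// ltr0q gmxP.
rewrite -[(_ * _)%:C%C]/(real_complex R _) (rmorphM (real_complex R)).
by rewrite exprD invfM [X in X * _ = _]mulrACA [LHS]mulrACA.
Qed.

Lemma modular_dvd N N' k (f : hfun) :
  (N %| N')%N -> modular N k f -> modular N' k f.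
Proof. by move=> NN' [hf sf bf]; split=> // g /(Gamma_dvd NN'); exact: sf. Qed.

Lemma modular_cst N (c : C) : modular N 0 (cst c : hfun).
Proof.
split=> [|g _|g _]; [exact: holomorphic_cst|exact: slash0|].
exists 0, (Num.sqrt (complex.Re c ^+ 2 + complex.Im c ^+ 2)) => z _.
by rewrite slash0 [X in X <= _]normc_def.
Qed.

Lemma modularB N k (f1 f2 : hfun) :
  modular N k f1 -> modular N k f2 -> modular N k (f1 - f2).
Proof.
move=> [hf1 sf1 bf1] [hf2 sf2 bf2]; split=> [|g gN|g g1].
- exact: holomorphicB.
- by rewrite slashB sf1// sf2.
have [A1 [B1 fB1]] := bf1 _ g1; have [A2 [B2 fB2]] := bf2 _ g1.
exists (Num.max A1 A2), (B1 + B2) => z; rewrite ge_max => /andP[z1 z2].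
rewrite slashB (rmorphD (real_complex R)).
by apply: le_trans (ler_normB _ _) _; apply: lerD; [exact: fB1|exact: fB2].
Qed.

Lemma modular0 N k : modular N k (0 : hfun).
Proof.
have s0 g : slash k g (0 : hfun) = 0.
  by apply/funext => z; rewrite /slash mulr0 mul0r.
split=> [|g _|g _]; [exact: (@holomorphic_cst 0)|exact: s0|].
by exists 0, 0 => z _; rewrite s0 normr0.
Qed.

Lemma modularD N k (f1 f2 : hfun) :
  modular N k f1 -> modular N k f2 -> modular N k (f1 + f2).
Proof.
move=> m1 m2; rewrite -[f2]opprK; apply: modularB => //.
by rewrite -sub0r; apply: modularB => //; exact: modular0.
Qed.

Lemma modularM N k l (f1 f2 : hfun) :
  modular N k f1 -> modular N l f2 -> modular N (k + l) (f1 * f2).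
Proof.
move=> [hf1 sf1 bf1] [hf2 sf2 bf2]; split=> [|g gN|g g1].
- exact: holomorphicM.
- by rewrite slashM sf1// sf2.
have [A1 [B1 fB1]] := bf1 _ g1; have [A2 [B2 fB2]] := bf2 _ g1.
exists (Num.max A1 A2), (B1 * B2) => z; rewrite ge_max => /andP[z1 z2].
rewrite slashM (rmorphM (real_complex R)) normrM.
by apply: ler_pM => //; [exact: fB1|exact: fB2].
Qed.

Lemma intmx_denom (a : 'M[rat]_2) : exists2 D : nat, (0 < D)%N &
  exists A : 'M[int]_2, D%:R *: a = map_mx intr A.
Proof.
pose D := (\prod_i \prod_j `|denq (a i j)|)%N.
have DE i j : (`|denq (a i j)| %| D)%N.
  by rewrite /D (bigD1 i)//= (bigD1 j)//= -mulnA dvdn_mulr.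
exists D; first by do 2!apply/prodn_gt0 => ?; rewrite absz_gt0 denq_neq0.
exists (\matrix_(i, j) (numq (a i j) * (D %/ `|denq (a i j)|)%N%:Z)).
apply/matrixP => i j; rewrite !mxE -[in LHS](divq_num_den (a i j)).
rewrite -{1}(divnK (DE i j)) natrM intrM.
have -> : `|denq (a i j)|%N%:R = (denq (a i j))%:~R :> rat.
  by rewrite -[LHS]/(Posz `|denq (a i j)|)%:~R absz_denq.
rewrite [RHS]mulrC -mulrA [X in _ * X]mulrCA.
by rewrite divff ?mulr1 ?intr_eq0 ?denq_neq0.
Qed.

Definition conj_level (N : nat) (a : GL2pQ) : nat := 
  (N * (s2val (cid2 (intmx_denom a)) * s2val (cid2 (intmx_denom (invmx a)))))%N.

Lemma conj_level_gt0 N a : (0 < N)%N -> (0 < conj_level N a)%N.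
Proof.
by move=> N0; rewrite !muln_gt0 N0; do 2!case: cid2 => ? ? _ /=; apply/andP.
Qed.

Lemma Gamma_conj N a g : Gamma (conj_level N a) g ->
  exists2 g', Gamma N g' & gmul a g = gmul g' a.
Proof.
rewrite /conj_level; case: cid2 => /= D1 D1_gt0 [A1 A1E].
case: cid2 => /= D2 D2_gt0 [A2 A2E] [m [gm m1 mN]].
have ua : gmx a \in unitmx by rewrite unitmxE unitfE gt_eqF ?gmxP.
have dg : 0 < \det (a *m g *m invmx a).
  by rewrite !det_mulmx det_inv mulrAC divff ?mul1r ?gmxP// gt_eqF ?gmxP.
exists (GL2p dg); last first.
  by apply/val_inj => /=; rewrite -!mulmxA mulVmx// mulmx1.
pose q : 'M[int]_2 := \matrix_(i, j)
  ((m i j - (1%:M : 'M[int]_2) i j) %/ (N * (D1 * D2))%N)%Z.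
have mE : m = 1%:M + (N * (D1 * D2))%N%:Z *: q.
  apply/matrixP => i j; rewrite !mxE.
  rewrite mulrC divzK; first by rewrite addrC subrK.
  by rewrite -eqz_mod_dvd; move: (mN i j); rewrite !mxE => ->.
pose M := 1%:M + N%:Z *: (A1 *m q *m A2).
have ME : (a *m g *m invmx a) = map_mx intr M.
  rewrite gm mE /M !map_mxD !map_scalar_mx !map_mxZ !map_mxM -A1E -A2E rmorph1.
  rewrite mulmxDr mulmx1 mulmxDl mulmxV//; congr (_ + _).
  rewrite -!scalemxAl -!scalemxAr -!scalemxAl !scalerA; congr (_ *: _).
  by rewrite -[RHS]mulrA -!natrM.
exists M; split.
- exact: ME.
- apply: (@intr_inj rat); rewrite -det_map_mx -ME !det_mulmx det_inv gm.
  by rewrite det_map_mx m1 mulr1 divff// gt_eqF ?gmxP.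
move=> i j; rewrite mxE [X in _ + X]mxE.
by apply/eqP; rewrite eqz_mod_dvd addrAC subrr add0r dvdz_mulr.
Qed.

Lemma Gamma1P (m : 'M[int]_2) (dm : 0 < \det (map_mx intr m : 'M[rat]_2)) :
  \det m = 1 -> Gamma 1 (GL2p dm).
Proof. by move=> m1; exists m; split=> // i j; rewrite !modz1. Qed.

Lemma Gamma1_triangular a g : Gamma 1 g ->
  exists g' b, [/\ Gamma 1 g', gmul a g = gmul g' b & b 1 0 = 0].
Proof.
move=> _; set h := gmul a g.
pose mx2 (p q r s : int) : 'M[int]_2 := \matrix_(i, j)
  if i == 0 then if j == 0 then p else q else if j == 0 then r else s.
have mx2M p q r s p' q' r' s' : mx2 p q r s *m mx2 p' q' r' s' =
    mx2 (p * p' + q * r') (p * q' + q * s') (r * p' + s * r') (r * q' + s * s').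
  apply/matrixP => i j; rewrite !mxE big_ord_recl big_ord1 !mxE /=.
  by case: (i == 0); case: (j == 0).
have mx2_1 : mx2 1 0 0 1 = 1%:M.
  by apply/matrixP => -[[|[|i]] ?] // -[[|[|j]] ?] //; rewrite !mxE.
have [u [v [uv u0]]] : exists u v : int,
    coprimez u v /\ v%:~R * h 0 0 = u%:~R * h 1 0.
  have [r0|r0] := eqVneq (h 1 0) 0.
    by exists 1, 0; rewrite r0 mulr0 mul0r.
  exists (numq (h 0 0 / h 1 0)), (denq (h 0 0 / h 1 0)); split.
    exact: coprime_num_den.
  by rewrite numqE; field.
have /coprimezP[[x y] /= xy] := uv.
have dg : \det (mx2 u (- y) v x) = 1 by rewrite det_mx2 !mxE /= -xy; ring.
have ds : \det (mx2 x y (- v) u) = 1 by rewrite det_mx2 !mxE /= -xy; ring.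
have dgq : 0 < \det (map_mx intr (mx2 u (- y) v x) : 'M[rat]_2).
  by rewrite det_map_mx dg.
have dsq : 0 < \det (map_mx intr (mx2 x y (- v) u) : 'M[rat]_2).
  by rewrite det_map_mx ds.
exists (GL2p dgq), (gmul (GL2p dsq) h); split; first exact: Gamma1P.
  apply/val_inj => /=; rewrite !mulmxA -map_mxM mx2M.
  have -> : u * x + - y * - v = 1 by rewrite -xy; ring.
  have -> : u * y + - y * u = 0 by ring.
  have -> : v * x + x * - v = 0 by ring.
  have -> : v * y + x * u = 1 by rewrite -xy; ring.
  by rewrite mx2_1 map_mx1 mul1mx.
have -> : gmul (GL2p dsq) h 1 0 = (- v)%:~R * h 0 0 + u%:~R * h 1 0.
  by rewrite gmulE; congr (_ * _ + _ * _); rewrite /= !mxE.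
by rewrite rmorphN mulNr u0 addNr.
Qed.

Lemma modular_slash N k a (f : hfun) : modular N k f ->
  modular (conj_level N a) k (slash k a f).
Proof.
move=> [hf sf bf]; split=> [|g|g g1]; first exact: holomorphic_slash.
  by move=> /Gamma_conj[g' g'N ag]; rewrite slash_gmul ag -slash_gmul sf.
have [g' [b [g'1 ag b10]]] := Gamma1_triangular a g1.
have [A [B fB]] := bf _ g'1.
rewrite slash_gmul ag.
have db : b 0 0 * b 1 1 > 0 by have := gmxP b; rewrite det_mx2 b10 mulr0 subr0.
have b11 : b 1 1 != 0 by apply: contraTneq db => ->; rewrite mulr0 ltxx.
pose p : R := ratr (b 0 0); pose r : R := ratr (b 1 1).
have pr : 0 < p * r by rewrite -rmorphM ltr0q.
have r0 : r != 0 by rewrite fmorph_eq0.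
have bE (z : uhp) : gden b z = r%:C%C :> C.
  by rewrite /gden b10 rmorph0 mul0r add0r ratCE.
have Imb (z : uhp) :
    complex.Im (uhp_val (mobius b z)) = p / r * complex.Im (uhp_val z).
  rewrite /= bE /gnum !ratCE -/p; case: (uhp_val z) => x y /=.
  by field.
have pr' : 0 < p / r.
  by rewrite (_ : p / r = (p * r) / r ^+ 2) ?divr_gt0 ?exprn_even_gt0//; field.
pose c : C := (ratr (\det b) `^ (k%:R / 2))%:C%C * (r%:C%C ^+ k)^-1.
exists (A / (p / r)), (Num.sqrt (complex.Re c ^+ 2 + complex.Im c ^+ 2) * B).
move=> z Az; rewrite -slash_gmul.
have {}Az : A <= complex.Im (uhp_val (mobius b z)).
  by rewrite Imb mulrC -ler_pdivrMr.
have -> : slash k b (slash k g' f) z = c * slash k g' f (mobius b z).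
  by rewrite {1}/slash bE mulrAC.
rewrite normrM (rmorphM (real_complex R)).
by apply: ler_pM => //; [rewrite [X in X <= _]normc_def | exact: fB].
Qed.

Definition expC (z : C) : C :=
  (expR (complex.Re z))%:C%C *
  Complex (cos (complex.Im z)) (sin (complex.Im z)).

Definition twopii : C := Complex 0 (2 * pi).

(* The branch of q^(1/24) is exp (2 pi i z / 24). *)
Definition eta (z : uhp) : C := expC (twopii * uhp_val z / 24) *
  limn (fun n =>
    \prod_(1 <= m < n.+1) (1 - expC (twopii * uhp_val z) ^+ m) : C).

Definition eta4 : hfun := fun z => eta z ^+ 4.

Definition Cintegral (D : set R) (f : R -> C) : C :=
  Complex (\int[lebesgue_measure]_(x in D) complex.Re (f x))
          (\int[lebesgue_measure]_(x in D) complex.Im (f x)).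

(* The function Z: the integral from i oo to z is taken along the vertical ray
   w = z + i t, 0 <= t < oo, on which dw = i dt; the ray runs away from z,
   whence the sign. *)
Definition Zint (z : uhp) : C :=
  twopii / 6 *
  - (Complex 0 1 *
     Cintegral `[0, +oo[ (fun t => extend eta4 (uhp_val z + Complex 0 t))).

(* dZ = (2 pi i / 6) eta^4 dz. *)
Definition ddZ (f : hfun) : hfun := fun z => 6 / (twopii * eta4 z) * ddz f z.

(* d/dz log f. *)
Definition dlog (f : hfun) : hfun := fun z => ddz f z / f z.

Definition mu (g : GL2pQ) : hfun := fun z =>
  twopii^-1 * dlog (fun w => slash 2 g eta4 w / eta4 w) z.

(* log_branch U F L: on the open set U, L is a holomorphic logarithm of F. *)
Definition log_branch (U : set C) (F L : hfun) : Prop :=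
  open U /\ forall z : uhp, U (uhp_val z) ->
    derivable (extend L) (uhp_val z) 1 /\ expC (L z) = F z.

Definition Ywt (k : nat) (f : hfun) : hfun := fun z => k%:R / 2 * f z.
Definition Xwt (k : nat) (f : hfun) : hfun := fun z =>
  twopii^-1 * ddz f z - twopii^-1 * dlog eta4 z * Ywt k f z.

(* The graded algebra of modular forms of all levels: a polynomial p stands for
   the element of the direct sum whose component of weight k is p`_k. *)
Definition in_modforms (p : {poly hfun}) :=
  exists2 N : nat, (0 < N)%N & forall k, modular N k p`_k.

Definition modform_pred : pred {poly hfun} := fun p => `[< in_modforms p >].

Lemma modularN_mul N1 N2 k (f : hfun) : modular N1 k f -> modular (N1 * N2) k f.
Proof. exact/modular_dvd/dvdn_mulr. Qed.

Lemma modform_subring : subring_closed modform_pred.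
Proof.
split.
- apply/asboolP; exists 1%N => // k; rewrite coef1.
  by case: k => [|k]; [exact: (@modular_cst 1 1)|exact: modular0].
- move=> p q /asboolP[M M0 pM] /asboolP[N N0 qN]; apply/asboolP.
  exists (M * N)%N; first by rewrite muln_gt0 M0.
  move=> k; rewrite coefB; apply: modularB; first exact: modularN_mul.
  by rewrite mulnC; exact: modularN_mul.
- move=> p q /asboolP[M M0 pM] /asboolP[N N0 qN]; apply/asboolP.
  exists (M * N)%N; first by rewrite muln_gt0 M0.
  move=> k; rewrite coefM; apply: big_ind => [|f g|[i /= ik] _].
  + exact: modular0.
  + exact: modularD.
  rewrite -[k in modular _ k](subnKC (_ : i <= k)%N)//; apply: modularM.
    exact: modularN_mul.
  by rewrite mulnC; exact: modularN_mul.
Qed.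
HB.instance Definition _ :=
  GRing.isSubringClosed.Build {poly hfun} modform_pred modform_subring.

Record modform :=
  Modform { mf_poly :> {poly hfun}; _ : mf_poly \in modform_pred }.
HB.instance Definition _ := [isSub for mf_poly].
HB.instance Definition _ := [Choice of modform by <:].
HB.instance Definition _ := [SubChoice_isSubComNzRing of modform by <:].

(* f|g, each component being acted upon with its own weight. *)
Definition pslash (g : GL2pQ) (p : {poly hfun}) : {poly hfun} :=
  \poly_(k < size p) slash k g p`_k.

Lemma pslash_modform g (f : modform) : pslash g (mf_poly f) \in modform_pred.
Proof.
case: f => p /= /asboolP[N N0 pN]; apply/asboolP.
exists (conj_level N g); first exact: conj_level_gt0.
move=> k; rewrite coef_poly; case: ifP => _; last exact: modular0.
exact: modular_slash.
Qed.
Definition mslash g (f : modform) : modform := Modform (pslash_modform g f).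

Lemma mconst_subproof (c : C) : (cst c)%:P \in modform_pred.
Proof.
apply/asboolP; exists 1%N => // -[|k]; rewrite coefC /=.
  exact: modular_cst.
exact: modular0.
Qed.
Definition mconst c : modform := Modform (mconst_subproof c).

(* f belongs to the weight k summand. *)
Definition weight (k : nat) (f : modform) :=
  forall j, j <> k -> (mf_poly f)`_j = 0.

(* M >< GL2+(Q): << f *g x >> stands for f U_x^*. *)
Definition crossed := {malg modform[GL2pQ]}.

Definition cmul (a b : crossed) : crossed :=
  \sum_(x <- msupp a) \sum_(y <- msupp b)
    << a@_x * mslash x b@_y *g gmul y x >>.

Lemma mslash0 g : mslash g 0 = 0.
Proof.
by apply/val_inj => /=; apply/polyP => k; rewrite coef_poly size_poly0 coef0.
Qed.

Lemma cmulU (f g : modform) x y :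
  cmul << f *g x >> << g *g y >> = << f * mslash x g *g gmul y x >>.
Proof.
rewrite /cmul.
have [->|f0] := eqVneq f 0.
  by rewrite monalgU0 msupp0 big_seq_fset0 mul0r monalgU0.
have [->|g0] := eqVneq g 0.
  rewrite monalgU0 msupp0 mslash0 mulr0 monalgU0 big1 // => i _.
  by rewrite big_seq_fset0.
rewrite !msuppU (negPf f0) (negPf g0) !big_seq_fset1 !mcoeffUU.
by [].
Qed.

Definition cscale (c : C) (a : crossed) : crossed := mconst c *: a.

Definition cone : crossed := << 1 *g gone >>.

Definition Ymod (p : {poly hfun}) : {poly hfun} :=
  \poly_(k < size p) Ywt k p`_k.
Definition Xmod (p : {poly hfun}) : {poly hfun} :=
  \sum_(k < size p) (Xwt k p`_k) *: 'X^(k + 2).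

(* In act_prod, s is any expression of Delta h as a sum of pure tensors. *)
Record hopf_action (act : H1 C -> crossed -> crossed) : Prop := {
  act_additive : forall h a b, act h (a + b) = act h a + act h b;
  act_scale : forall h c a, act h (cscale c a) = cscale c (act h a);
  act_addl : forall h h' a, act (h + h') a = act h a + act h' a;
  act_scalel : forall h c a, act (c *: h) a = cscale c (act h a);
  act_1 : forall a, act 1 a = a;
  act_mul : forall h h' a, act (h * h') a = act h (act h' a);
  act_prod : forall h (s : seq (H1 C * H1 C)),
    Delta h = \sum_(x <- s) tens x.1 x.2 ->
    forall a b, act h (cmul a b) = \sum_(x <- s) cmul (act x.1 a) (act x.2 b);
  act_unit : forall h, act h cone = cscale (counit h) cone
}.

End ModularForms.

(* Main.v *)
(* Since delta_(n+1) = [X, delta_n] and X is a derivation of the modular forms,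
   delta_n multiplies by h_n, where h_1 = mu and h_(n+1) = X h_n.  As X kills
   eta^4, it sends the differential F (dZ)^m to (dF/dZ) (dZ)^(m+1); and
   d(Z|gamma)/dZ = (eta^4|gamma) / eta^4 gives h_1.

   Analytically, all that is needed is that eta^4 is holomorphic without zeros
   and that Z' = (2 pi i / 6) eta^4.  The partial products of eta^4 are sums
   G_n(z) = sum_k c_(n,k) e^(2 pi i (k + 1/6) z) whose coefficients are dominated
   by those of (prod_(m <= n) (1 + X^m))^4, uniformly bounded at each r < 1.  Hence
   the quadratic Taylor remainders of the G_n, and of their termwise primitives,
   are bounded uniformly in n, and the derivatives pass to the pointwise
   limits. *)

Require Import Defs.
From mathcomp Require Import all_boot all_order all_algebra.
From mathcomp Require Import complex finmap.
From mathcomp Require Import monalg.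
From mathcomp Require Import all_classical all_reals all_analysis.
From mathcomp Require Import measurable_realfun.
From mathcomp Require Import ring lra.

Set Implicit Arguments.
Unset Strict Implicit.
Unset Printing Implicit Defensive.
Import Order.TTheory GRing.Theory Num.Theory.
Import numFieldNormedType.Exports.
Local Open Scope classical_set_scope.
Local Open Scope ring_scope.

(** * Complex limits and quadratic remainders *)

Section ComplexBasics.
Variable R : realType.
Local Notation C := (Cx R).
Local Notation normc := (@ComplexField.Normc.normc R : C -> R).

(** The norm of a [numFieldType] takes values in the field itself. Passing to the real-valued
    [normc] allows all estimates to be made in [R]. *)
Lemma normE (z : C) : `|z| = (normc z)%:C%C. Proof. by []. Qed.
Lemma normcD (z w : C) : normc (z + w) <= normc z + normc w.
Proof. by rewrite -lecR (rmorphD (real_complex R)); exact: (@ler_normD _ C z w). Qed.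
Lemma normcN (z : C) : normc (- z) = normc z.
Proof. by case: z => x y /=; rewrite !sqrrN. Qed.
Lemma normcB (z w : C) : normc (z - w) = normc (w - z).
Proof. by rewrite -normcN opprB. Qed.
Lemma normcM (z w : C) : normc (z * w) = normc z * normc w.
Proof. exact: ComplexField.Normc.normcM. Qed.
Lemma normc_ge0 (z : C) : 0 <= normc z.
Proof. by rewrite -lecR; exact: (@normr_ge0 _ C z). Qed.
Lemma normc0 : normc 0 = 0.
Proof. exact: ComplexField.Normc.normc0. Qed.
Lemma normc1 : normc 1 = 1.
Proof. exact: ComplexField.Normc.normc1. Qed.
Lemma normcX (z : C) n : normc (z ^+ n) = normc z ^+ n.
Proof. by elim: n => [|n IH]; rewrite ?expr0 ?normc1// !exprS normcM IH. Qed.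
Lemma normcR (x : R) : normc x%:C%C = `|x|.
Proof. by rewrite /= expr0n addr0 sqrtr_sqr. Qed.
Lemma Re_le_normc (z : C) : `|complex.Re z| <= normc z.
Proof. by rewrite -lecR; exact: normc_ge_Re. Qed.
Lemma Im_le_normc (z : C) : `|complex.Im z| <= normc z.
Proof.
by case: z => x y /=; rewrite -sqrtr_sqr ler_wsqrtr// lerDr sqr_ge0.
Qed.
Lemma normc_le_ReIm (z : C) : normc z <= `|complex.Re z| + `|complex.Im z|.
Proof.
case: z => x y /=.
rewrite -[leRHS]ger0_norm ?addr_ge0// -sqrtr_sqr ler_wsqrtr//.
rewrite sqrrD !real_normK ?num_real// lerD2r lerDl mulrn_wge0//.
Qed.

(** In the partial order on [C], comparable elements have equal imaginary parts, so the radii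
    occurring in complex filters are real. *)
Lemma pos_realc (e : C) : 0 < e -> exists2 d : R, 0 < d & e = d%:C%C.
Proof.
case: e => x y; rewrite ltcE /= => /andP[/eqP y0 x0].
by exists x => //; rewrite y0.
Qed.

Lemma cvgC_normP (T : Type) (F : set_system T) {FF : Filter F} (u : T -> C) (l : C) :
  u @ F --> l <-> forall e : R, 0 < e -> \forall t \near F, normc (l - u t) < e.
Proof.
split=> [/cvgrPdist_lt ul e e0|ul].
  have e0' : 0 < e%:C%C :> C by rewrite ltcR.
  by apply: filterS (ul _ e0') => t; rewrite normE ltcR.
apply/cvgrPdist_lt => e /pos_realc[d d0 ->].
by apply: filterS (ul _ d0) => t; rewrite normE ltcR.
Qed.

Lemma ReB (z w : C) : complex.Re (z - w) = complex.Re z - complex.Re w.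
Proof. by case: z w => x y [u v]. Qed.
Lemma ImB (z w : C) : complex.Im (z - w) = complex.Im z - complex.Im w.
Proof. by case: z w => x y [u v]. Qed.

Lemma cvgC_ReImP (T : Type) (F : set_system T) {FF : Filter F} (u : T -> C) (l : C) :
  u @ F --> l <-> (fun t => complex.Re (u t)) @ F --> complex.Re l /\
                (fun t => complex.Im (u t)) @ F --> complex.Im l.
Proof.
split=> [/cvgC_normP ul|[/cvgrPdist_lt rl /cvgrPdist_lt il]].
  split; apply/cvgrPdist_lt => e e0; apply: filterS (ul _ e0) => t.
    by apply: le_lt_trans; rewrite -ReB; exact: Re_le_normc.
  by apply: le_lt_trans; rewrite -ImB; exact: Im_le_normc.
apply/cvgC_normP => e e0.
have e2 : 0 < e / 2 by rewrite divr_gt0.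
apply: filterS2 (rl _ e2) (il _ e2) => t h1 h2.
apply: le_lt_trans (normc_le_ReIm _) _.
by rewrite ReB ImB (splitr e) ltrD.
Qed.

(** Completeness is inherited from [R]: real and imaginary parts are dominated by the modulus, hence
    are Cauchy too. *)
Lemma cauchyC_cvgn (u : nat -> C) :
    (forall e : R, 0 < e -> exists N, forall m n, (N <= m)%N -> (N <= n)%N ->
      normc (u m - u n) < e) ->
  cvgn u.
Proof.
move=> uC.
have cR (v : nat -> R) : (forall m n, `|v m - v n| <= normc (u m - u n)) -> cvgn v.
  move=> vu; apply: cauchy_cvg; apply: cauchy_exP => e e0.
  have [N uN] := uC _ e0.
  exists (v N); exists N => // n /= Nn.
  by rewrite -ball_normE /ball_/=; apply: le_lt_trans (vu _ _) (uN _ _ _ _).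
have /cvg_ex[a ra] : cvgn (fun n => complex.Re (u n)).
  by apply: cR => m n; rewrite -ReB; exact: Re_le_normc.
have /cvg_ex[b rb] : cvgn (fun n => complex.Im (u n)).
  by apply: cR => m n; rewrite -ImB; exact: Im_le_normc.
by apply/cvg_ex; exists (Complex a b : C); apply/cvgC_ReImP.
Qed.

(** The difference quotient at [w] deviates from [a] by at most [B] times the modulus of [w - z]. A
    quadratic remainder, unlike a derivative, survives pointwise limits, whence this criterion. *)
Lemma quad_is_derive (F : C -> C) (z a : C) (B r : R) : 0 < r ->
    (forall w, normc (w - z) < r ->
      normc (F w - F z - a * (w - z)) <= B * normc (w - z) ^+ 2) ->
  is_derive z 1 F a.
Proof.
move=> r0 HF.
have FD : (fun h : C => h^-1 *: (F (h *: (1 : C) + z) - F z)) @ 0^' --> a.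
  apply/cvgC_normP => e e0.
  (* The sign of [B] is not prescribed, so the positive number [|B| + 1] takes its place in the
     choice of the radius. *)
  have d0 : 0 < Num.min r (e / (`|B| + 1)).
    by rewrite lt_min r0 divr_gt0// ltr_wpDl.
  have d0' : 0 < (Num.min r (e / (`|B| + 1)))%:C%C :> C by rewrite ltcR.
  apply/nbhs_ballP; exists (Num.min r (e / (`|B| + 1)))%:C%C => //= h.
  rewrite -ball_normE /ball_ /= sub0r normrN normE ltcR lt_min => /andP[hr he] h0.
  have {}h0 : h != 0 by [].
  have nh0 : 0 < normc h by rewrite -ltcR -normE normr_gt0.
  have -> : a - h^-1 *: (F (h *: (1 : C) + z) - F z) =
      - (h^-1 * (F (h + z) - F z - a * (h + z - z))).
    have -> : h *: (1 : C) = h by exact: mulr1.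
    rewrite -[_ *: _]/(_ * _) addrK.
    by field.
  rewrite normcN normcM.
  have -> : normc h^-1 = (normc h)^-1 by exact: ComplexField.Normc.normcV.
  have := HF (h + z); rewrite addrK => /(_ hr) H.
  rewrite mulrC ltr_pdivrMr//; apply: le_lt_trans H _.
  rewrite expr2 mulrA ltr_pM2r//.
  have B1 : 0 < `|B| + 1 by rewrite ltr_wpDl.
  move: he; rewrite ltr_pdivlMr// => he.
  apply: le_lt_trans he; rewrite mulrC ler_pM2l//.
  by rewrite (le_trans (ler_norm _))// lerDl.
apply: DeriveDef; first by apply/cvg_ex; exists a.
exact: cvg_lim FD.
Qed.

Lemma cvg_norm_le (u : nat -> C) (l : C) (M : R) :
  u @ \oo --> l -> (forall n, normc (u n) <= M) -> normc l <= M.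
Proof.
move=> /cvgC_normP ul uM; apply/ler_addgt0Pr => e e0.
have [N _ uN] := ul _ e0.
rewrite -[l](subrK (u N)) addrC; apply: le_trans (normcD _ _) _.
by rewrite lerD// ltW//; apply: uN => /=.
Qed.

(* The slopes [a n] converge for free: once [w] is close to [z], they differ
   from the convergent difference quotients by [O(w - z)] uniformly in [n]. *)
Lemma quad_cvg (F : nat -> C -> C) (G : C -> C) (a : nat -> C) (z : C)
    (B r : R) : 0 < r ->
    (forall n w, normc (w - z) < r ->
      normc (F n w - F n z - a n * (w - z)) <= B * normc (w - z) ^+ 2) ->
    (forall w, normc (w - z) < r -> F n w @[n --> \oo] --> G w) ->
  exists2 l, a @ \oo --> l & is_derive z 1 G l.
Proof.
move=> r0 HF FG.
have zr : normc (z - z) < r by rewrite subrr normc0.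
have /cvg_ex[l al] : cvgn a.
  apply: cauchyC_cvgn => e e0.
  have B1 : 0 < `|B| + 1 by rewrite ltr_wpDl.
  (* At distance [h] each of the two Taylor remainders is at most [e / 4 * h]. The four errors of
     convergence, at [w] and at [z], will each be below [e / 8 * h], so that the total stays below
     [e * h]. *)
  pose h := Num.min (r / 2) (e / 4 / (`|B| + 1)).
  have h0 : 0 < h by rewrite lt_min !divr_gt0.
  have hr : h < r.
    by rewrite gt_min (_ : r / 2 < r)//; move: r0; lra.
  have he : (`|B| + 1) * h <= e / 4.
    by rewrite -ler_pdivlMl// mulrC ge_min lexx orbT.
  pose w : C := h%:C%C + z.
  have wz : w - z = h%:C%C by rewrite /w addrK.
  have nwz : normc (w - z) = h by rewrite wz normcR gtr0_norm.
  have e4 : 0 < e / 8 * h by rewrite mulr_gt0// divr_gt0.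
  have wr : normc (w - z) < r by rewrite nwz.
  have /cvgC_normP/(_ _ e4)[N1 _ FN1] := FG w wr.
  have /cvgC_normP/(_ _ e4)[N2 _ FN2] := FG z zr.
  exists (maxn N1 N2) => m n; rewrite !geq_max => /andP[m1 m2] /andP[n1 n2].
  rewrite -(ltr_pM2r h0) -{1}nwz -normcM.
  have -> : (a m - a n) * (w - z) =
     (G w - F n w) - (G w - F m w) - ((G z - F n z) - (G z - F m z))
      + ((F n w - F n z - a n * (w - z)) - (F m w - F m z - a m * (w - z))).
    by ring.
  have := HF n w; have := HF m w; rewrite nwz => /(_ hr) Hm /(_ hr) Hn.
  have := FN1 m m1; have := FN1 n n1; have := FN2 m m2; have := FN2 n n2 => /=.
  move: (G w - F n w) (G w - F m w) (G z - F n z) (G z - F m z).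
  move: (F n w - F n z - _) (F m w - F m z - _) Hm Hn.
  move=> p q Hq Hp x y x' y' hx hy hx' hy'.
  apply: le_lt_trans (normcD _ _) _.
  have H1 := normcD (x - y) (- (x' - y')).
  have H2 := normcD x (- y); have H3 := normcD x' (- y').
  have H4 := normcD p (- q).
  rewrite !normcN in H1 H2 H3 H4.
  have HB : B * h ^+ 2 <= e / 4 * h.
    rewrite expr2 mulrA ler_pM2r// (le_trans _ he)// ler_pM2r//.
    by rewrite (le_trans (ler_norm _))// lerDl.
  lra.
exists l; first exact: al.
apply: (@quad_is_derive G z l B r r0) => w wr.
apply: (@cvg_norm_le (fun n => F n w - F n z - a n * (w - z))); last first.
  by move=> n; exact: HF.
apply: (@cvgB _ _ _ _ _ (fun n => F n w - F n z) (fun n => a n * (w - z))).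
  by apply: cvgB; exact: FG.
by apply: cvgM; [exact: al|exact: cvg_cst].
Qed.
End ComplexBasics.

(** * The complex exponential *)

Section ExpC.
Variable R : realType.
Local Notation C := (Cx R).
Local Notation normc := (@ComplexField.Normc.normc R : C -> R).
Implicit Types (x y : R) (u v z w : C).

Lemma expCD u v : expC (u + v) = expC u * expC v.
Proof.
case: u v => [x y] [x' y']; rewrite /expC /= expRD cosD sinD.
by apply/eqP; rewrite eq_complex /=; apply/andP; split; apply/eqP; ring.
Qed.
Lemma expC_real x : expC x%:C%C = (expR x)%:C%C.
Proof. by rewrite /expC /= cos0 sin0 mulr1. Qed.
Lemma expC0 : expC (0 : C) = 1.
Proof. by rewrite (expC_real 0) expR0. Qed.
Lemma normc_expC u : normc (expC u) = expR (complex.Re u).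
Proof.
rewrite /expC normcM normcR ger0_norm ?expR_ge0//=.
by rewrite cos2Dsin2 sqrtr1 mulr1.
Qed.
Lemma expC_neq0 u : expC u != 0.
Proof. by rewrite -normr_eq0 normE normc_expC eq_complex /= gt_eqF ?expR_gt0. Qed.
Lemma expCMn u n : expC (n%:R * u) = expC u ^+ n.
Proof.
elim: n => [|n IH]; first by rewrite mul0r expC0.
by rewrite -natr1 mulrDl mul1r expCD IH exprSr.
Qed.

Lemma expR_ge1 x : 0 <= x -> 1 <= expR x.
Proof. by move=> x0; rewrite -expR0 ler_expR. Qed.

(** For [x >= 0] this is [1 - x <= exp (- x)] multiplied by [exp x]; for [x < 0] already
    [1 - exp x <= - x]. *)
Lemma normr_expR_sub1 x : `|expR x - 1| <= `|x| * expR `|x|.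
Proof.
have [x0|x0] := leP 0 x.
  rewrite !ger0_norm ?subr_ge0 ?expR_ge1//.
  have := expR_ge1Dx (- x); rewrite expRN.
  have := expR_gt0 x => e0; rewrite -(ler_pM2r e0) mulVf ?gt_eqF//; lra.
have e1 : expR x <= 1 by rewrite -expR0 ler_expR ltW.
rewrite distrC ger0_norm ?subr_ge0// ltr0_norm//.
apply: (@le_trans _ _ (- x)); first by have := expR_ge1Dx x; lra.
by rewrite ler_peMr ?expR_ge1 ?oppr_ge0 ?ltW// oppr_cp0.
Qed.

Lemma normr_sin x : `|sin x| <= `|x|.
Proof.
wlog x0 : x / 0 <= x.
  move=> H; have [/H//|/ltW x0] := leP 0 x.
  by rewrite -normrN -sinN -(normrN x); apply: H; rewrite oppr_ge0.
have [|c _] := @MVT_segment R sin cos _ _ x0 (fun c _ => is_derive_sin c).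
  by apply: continuous_subspaceT; exact: continuous_sin.
by rewrite sin0 !subr0 => ->; rewrite normrM ler_piMl// cos_max.
Qed.

Lemma cos_half x : 1 - cos x = 2 * sin (x / 2) ^+ 2.
Proof.
rewrite {1}(_ : x = (x / 2) *+ 2); last by rewrite -mulr_natr divfK.
by rewrite cos_mulr2n cos2sin2; ring.
Qed.

Lemma cos_sub1_le x : `|cos x - 1| <= x ^+ 2.
Proof.
rewrite distrC cos_half normrM normrX (ger0_norm (_ : 0 <= 2))//.
have := normr_sin (x / 2); rewrite normrM (ger0_norm (_ : 0 <= 2^-1 :> R))//.
have := normr_ge0 (sin (x / 2)); rewrite -(real_normK (num_real x)).
have := normr_ge0 x; nra.
Qed.

(** By oddness [x >= 0] may be assumed. The mean value theorem for [sin x - x] leaves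
    [1 - cos c = 2 sin(c/2)^2], at most [2 |sin(c/2)|], hence at most [c]. *)
Lemma sin_sub_le x : `|sin x - x| <= x ^+ 2.
Proof.
wlog x0 : x / 0 <= x.
  move=> H; have [/H//|/ltW x0] := leP 0 x.
  by have := H (- x); rewrite sinN opprK sqrrN addrC distrC oppr_ge0; exact.
have sD (c : R) : is_derive c 1 (sin \- id) ((cos \- cst 1) c) by apply: is_deriveB.
have [|c /itvP cx] := @MVT_segment R _ _ _ _ x0 (fun c _ => sD c).
  apply: continuous_subspaceT => c; apply: cvgB; last exact: cvg_id.
  exact: continuous_sin.
rewrite /= sin0 !subr0 => ->; rewrite normrM expr2 (ger0_norm x0)//.
apply: ler_wpM2r => //; apply: (@le_trans _ _ c); last by rewrite cx.
rewrite distrC cos_half normrM (ger0_norm (_ : 0 <= 2))// normrX.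
have c0 : 0 <= c by rewrite cx.
have := normr_sin (c / 2); rewrite (ger0_norm (divr_ge0 c0 _))//.
have := sin_max (c / 2); have := normr_ge0 (sin (c / 2)); nra.
Qed.

(** Multiplying [1 - x <= exp (- x)] by [exp x] gives [exp x - 1 - x <= x (exp x - 1)], and
    [normr_expR_sub1] bounds the last factor. *)
Lemma expR_quad x : `|expR x - 1 - x| <= x ^+ 2 * expR `|x|.
Proof.
rewrite ger0_norm; last by have := expR_ge1Dx x; lra.
apply: (@le_trans _ _ (x * (expR x - 1))).
  have := expR_ge1Dx (- x); rewrite expRN.
  have e0 := expR_gt0 x; rewrite -(ler_pM2r e0) mulVf ?gt_eqF//; lra.
apply: le_trans (ler_norm _) _; rewrite normrM -(real_normK (num_real x)).
by rewrite expr2 -mulrA ler_wpM2l// normr_expR_sub1.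
Qed.

(** The real and imaginary parts of the remainder are each split into two pieces controlled by the
    real estimates above; each of the four pieces is at most [r ^+ 2 * expR r], whence the constant
    4. *)
Lemma expC_quad u : normc (expC u - 1 - u) <= 4 * normc u ^+ 2 * expR (normc u).
Proof.
have Rle := Re_le_normc u; have Ile := Im_le_normc u.
apply: le_trans (normc_le_ReIm _) _.
case: u Rle Ile => x y /=; set r := Num.sqrt _ => xr yr.
rewrite !mul0r subr0 addr0 !oppr0 !addr0.
have r0 : 0 <= r by exact: sqrtr_ge0.
have E1 : 1 <= expR r by exact: expR_ge1.
have xE : expR x <= expR r by rewrite ler_expR (le_trans (ler_norm _)).
have xE' : expR `|x| <= expR r by rewrite ler_expR.
have x2 : x ^+ 2 <= r ^+ 2 by rewrite -(real_normK (num_real x)) lerXn2r ?nnegrE.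
have y2 : y ^+ 2 <= r ^+ 2 by rewrite -(real_normK (num_real y)) lerXn2r ?nnegrE.
have e1 : `|expR x * cos y - 1 - x| <= r ^+ 2 * expR r + r ^+ 2 * expR r.
  rewrite (_ : _ - x = (expR x - 1 - x) + (cos y - 1) * expR x); last by ring.
  apply: le_trans (ler_normD _ _) _; apply: lerD.
    by apply: le_trans (expR_quad x) _; apply: ler_pM => //; rewrite ?sqr_ge0 ?expR_ge0.
  rewrite normrM (ger0_norm (expR_ge0 x)); apply: ler_pM => //.
  exact: le_trans (cos_sub1_le _) _.
have e2 : `|expR x * sin y - y| <= r ^+ 2 * expR r + r ^+ 2 * expR r.
  rewrite (_ : _ - y = (expR x - 1) * sin y + (sin y - y) * 1); last by ring.
  apply: le_trans (ler_normD _ _) _; rewrite !normrM; apply: lerD.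
    apply: le_trans (_ : (r * expR r) * r <= _); last by rewrite mulrAC expr2.
    apply: ler_pM => //; last exact: le_trans (normr_sin y) _.
    apply: le_trans (normr_expR_sub1 x) _.
    by apply: ler_pM => //; rewrite expR_ge0.
  rewrite normr1; apply: ler_pM => //.
  exact: le_trans (sin_sub_le _) _.
apply: le_trans (lerD e1 e2) _.
lra.
Qed.

(** The addition theorem moves the estimate [expC_quad] from 0 to [z]; on the unit disc its
    exponential factor is at most [expR 1]. *)
Lemma is_derive_expC z : is_derive z 1 (@expC R) (expC z).
Proof.
apply: (@quad_is_derive _ _ _ _ (normc (expC z) * (4 * expR 1)) 1) => // w wz.
have -> : expC w - expC z - expC z * (w - z) = expC z * (expC (w - z) - 1 - (w - z)).
  by rewrite !mulrBr mulr1 -expCD [z + _]addrC subrK.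
rewrite normcM -mulrA ler_wpM2l ?normc_ge0//.
apply: le_trans (expC_quad _) _; rewrite mulrAC ler_wpM2r ?sqr_ge0//.
by rewrite ler_wpM2l// ler_expR ltW.
Qed.
End ExpC.

(** * The Euler product *)

Section EulerProduct.
Variable R : realType.
Local Notation C := (Cx R).
Local Notation normc := (@ComplexField.Normc.normc R : C -> R).

Lemma sum_geo_le (r : R) n : 0 <= r < 1 ->
  \sum_(1 <= m < n.+1) r ^+ m <= r / (1 - r).
Proof.
move=> /andP[r0 r1]; have r1' : 0 < 1 - r by rewrite subr_gt0.
rewrite ler_pdivlMr// (_ : _ * _ = r - r ^+ n.+1).
  by rewrite lerBlDr lerDl exprn_ge0.
elim: n => [|n IH]; first by rewrite big_nil mul0r expr1 subrr.
by rewrite big_nat_recr//= mulrDl IH [r ^+ n.+2]exprS; ring.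
Qed.

(** The fourth power is that of eta^4: evaluated at q, [euler_poly n] is the n-th partial product of
    eta^4 without its factor q^(1/6). With all signs made positive, it becomes a polynomial that
    dominates it coefficientwise. *)
Definition majorant_poly n : {poly R} := (\prod_(1 <= m < n.+1) (1 + 'X^m)) ^+ 4.
Definition euler_poly n : {poly C} := (\prod_(1 <= m < n.+1) (1 - 'X^m)) ^+ 4.

(** From [1 + x <= exp x] and the geometric series; the point is a bound free of [n]. *)
Lemma prod_1D_le (r : R) n : 0 <= r < 1 ->
  \prod_(1 <= m < n.+1) (1 + r ^+ m) <= expR (r / (1 - r)).
Proof.
move=> r01; apply: le_trans (_ : _ <= expR (\sum_(1 <= m < n.+1) r ^+ m)) _.
  rewrite expR_sum; apply: ler_prod => m _.
  by rewrite addr_ge0 ?exprn_ge0 ?expR_ge1Dx//; case/andP: r01.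
by rewrite ler_expR sum_geo_le.
Qed.

Lemma majorant_poly_le (r : R) n : 0 <= r < 1 ->
  (majorant_poly n).[r] <= expR (r / (1 - r)) ^+ 4.
Proof.
move=> r01; rewrite /majorant_poly horner_exp horner_prod.
under eq_bigr do rewrite hornerD hornerC hornerXn.
rewrite lerXn2r ?nnegrE ?expR_ge0 ?prod_1D_le//.
by rewrite prodr_ge0// => m _; rewrite addr_ge0 ?exprn_ge0//; case/andP: r01.
Qed.

Definition majorizes (P : {poly R}) (p : {poly C}) := forall k, normc p`_k <= P`_k.

Lemma normc_sum (I : Type) (s : seq I) (P : pred I) (f : I -> C) :
  normc (\sum_(i <- s | P i) f i) <= \sum_(i <- s | P i) normc (f i).
Proof.
elim/big_rec2: _ => [|i y x _ H]; first by rewrite normc0.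
by apply: le_trans (normcD _ _) _; rewrite lerD2l.
Qed.

Lemma majorizes_ge0 P p k : majorizes P p -> 0 <= P`_k.
Proof. by move=> Pp; apply: le_trans (Pp k); exact: normc_ge0. Qed.

Lemma majorizesM P p P' p' : majorizes P p -> majorizes P' p' ->
  majorizes (P * P') (p * p').
Proof.
move=> Pp Pp' k; rewrite !coefM; apply: le_trans (normc_sum _ _ _) _.
by apply: ler_sum => i _; rewrite normcM ler_pM ?normc_ge0.
Qed.

Lemma majorizes1 : majorizes 1 1.
Proof. by move=> k; rewrite !coef1; case: eqP; rewrite ?normc1 ?normc0. Qed.

Lemma euler_poly_majorized n : majorizes (majorant_poly n) (euler_poly n).
Proof.
have H : majorizes (\prod_(1 <= m < n.+1) (1 + 'X^m)) (\prod_(1 <= m < n.+1) (1 - 'X^m)).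
  elim/big_rec2: _ => [|i P p _ Pp]; first exact: majorizes1.
  apply: majorizesM => // k; rewrite coefB coefD !coef1 !coefXn.
  by apply: le_trans (normcD _ _) _; rewrite normcN; case: eqP; case: eqP;
    rewrite ?normc1 ?normc0.
by do ![exact: H | apply: majorizesM].
Qed.

(** Allows the coefficients of both polynomials to be summed over one range, that of the
    majorant. *)
Lemma majorizes_size P p : majorizes P p -> (size p <= size P)%N.
Proof.
move=> Pp; apply/leq_sizeP => j jP; apply: ComplexField.Normc.eq0_normc.
by apply/eqP; rewrite eq_le normc_ge0 andbT (le_trans (Pp j))// nth_default.
Qed.

Lemma normc_prod (s : seq nat) (f : nat -> C) :
  normc (\prod_(i <- s) f i) = \prod_(i <- s) normc (f i).
Proof.
by elim/big_rec2: _ => [|i y x _ <-]; rewrite ?normc1 ?normcM.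
Qed.

Lemma euler_prod_le (q : C) n : normc q < 1 ->
  normc (\prod_(1 <= m < n.+1) (1 - q ^+ m)) <= expR (normc q / (1 - normc q)).
Proof.
move=> q1; rewrite normc_prod.
apply: le_trans (prod_1D_le n (_ : 0 <= normc q < 1)); last by rewrite normc_ge0.
apply: ler_prod => m _; rewrite normc_ge0 -normcX -normc1.
by apply: le_trans (normcD _ _) _; rewrite normcN.
Qed.

(** Consecutive partial products differ by [u m * q ^+ m.+1], and the [u m] are bounded, so the
    increments decay geometrically. *)
Lemma euler_prod_cvg (q : C) : normc q < 1 ->
  cvgn (fun n => \prod_(1 <= m < n.+1) (1 - q ^+ m) : C).
Proof.
move=> q1; set r := normc q; have r0 : 0 <= r := normc_ge0 q.
set u := (fun n => _); have r1 : 0 < 1 - r by rewrite subr_gt0.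
set M := expR (r / (1 - r)).
have M0 : 0 < M by exact: expR_gt0.
(* The right-hand side is the closed form of the sum of [M * r ^+ (n + j)] over [j < k], which makes
   the induction on [k] go through. *)
have uD n k : normc (u (n + k)%N - u n) <= M / (1 - r) * r ^+ n * (1 - r ^+ k).
  elim: k => [|k IH]; first by rewrite addn0 subrr normc0 expr0 subrr mulr0.
  have -> : u (n + k.+1)%N - u n = (u (n + k)%N - u n) - u (n + k)%N * q ^+ (n + k).+1.
    by rewrite /u addnS big_nat_recr//= mulrBr mulr1 addrAC.
  apply: le_trans (normcD _ _) _; rewrite normcN normcM normcX -/r.
  have -> : M / (1 - r) * r ^+ n * (1 - r ^+ k.+1) =
     M / (1 - r) * r ^+ n * (1 - r ^+ k) + M * r ^+ (n + k).
    by rewrite exprS exprD; field; rewrite gt_eqF.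
  apply: lerD => //; apply: ler_pM; rewrite ?normc_ge0 ?exprn_ge0//.
    exact: euler_prod_le.
  by rewrite exprS ler_piMl ?exprn_ge0// ltW.
apply: cauchyC_cvgn => e e0.
have : (fun n => r ^+ n) @ \oo --> 0 by apply: cvg_expr; rewrite ger0_norm.
have d0 : 0 < e / (M / (1 - r)) by rewrite !divr_gt0.
move=> /cvgrPdist_lt/(_ _ d0)[N _ rN]; exists N.
have uN n k : (N <= n)%N -> normc (u (n + k)%N - u n) < e.
  move=> /rN /=; rewrite sub0r normrN ger0_norm ?exprn_ge0// ltr_pdivlMr ?divr_gt0//.
  move=> rn; apply: le_lt_trans (uD n k) _.
  apply: le_lt_trans rn; rewrite [r ^+ n * _]mulrC ler_piMr ?gerBl ?exprn_ge0//.
  by rewrite mulr_ge0 ?exprn_ge0// divr_ge0 ?ltW.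
move=> m n Nm Nn; have [mn|/ltnW nm] := leqP m n.
  by rewrite normcB -(subnKC mn); exact: uN.
by rewrite -(subnKC nm); exact: uN.
Qed.

(** Nonzero factors alone do not keep an infinite product away from 0; a lower bound uniform in [n]
    does. It comes from [1 / (1 - x) <= 1 + x / (1 - r) <= exp (x / (1 - r))] for [0 <= x <= r < 1],
    applied to [x = r ^+ m]. *)
Lemma euler_prod_ge (q : C) n : normc q < 1 ->
  expR (- (normc q / (1 - normc q) / (1 - normc q))) <=
  normc (\prod_(1 <= m < n.+1) (1 - q ^+ m)).
Proof.
move=> q1; rewrite normc_prod; set r := normc q.
have r0 : 0 <= r := normc_ge0 q; have r1 : 0 < 1 - r by rewrite subr_gt0.
apply: le_trans (_ : expR (\sum_(1 <= m < n.+1) - (r ^+ m / (1 - r))) <= _).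
  rewrite ler_expR sumrN lerN2 -mulr_suml ler_pM2r ?invr_gt0//.
  by rewrite sum_geo_le// r0.
rewrite expR_sum [leLHS]big_nat_cond [leRHS]big_nat_cond.
apply: ler_prod => -[//|m] _; rewrite expR_ge0/=.
have rm : r ^+ m.+1 <= r by rewrite exprS ler_piMr// exprn_ile1// ltW// -subr_gt0.
apply: (@le_trans _ _ (1 - r ^+ m.+1)); last first.
  have := normcD (1 - q ^+ m.+1) (q ^+ m.+1).
  by rewrite subrK normc1 normcX -/r; lra.
have p0 : 0 < 1 - r ^+ m.+1 by lra.
rewrite expRN -[leRHS]invrK lef_pV2 ?posrE ?invr_gt0 ?expR_gt0//.
apply: le_trans (expR_ge1Dx _).
rewrite -(ler_pM2r p0) mulVf ?gt_eqF// -(ler_pM2r r1).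
rewrite mulrAC mulrDl mul1r divfK ?gt_eqF//.
have := exprn_ge0 m.+1 r0; nra.
Qed.

Lemma euler_prod_lim_neq0 (q : C) : normc q < 1 ->
  limn (fun n => \prod_(1 <= m < n.+1) (1 - q ^+ m) : C) != 0.
Proof.
move=> q1; apply/eqP => l0; have : _ @ \oo --> _ := euler_prod_cvg q1; rewrite l0.
have e0 := expR_gt0 (- (normc q / (1 - normc q) / (1 - normc q))).
move=> /cvgC_normP/(_ _ e0)[N _ /(_ N (leqnn _))].
by rewrite sub0r normcN ltNge euler_prod_ge.
Qed.
End EulerProduct.

(** * Integrals of real exponentials *)

Section ExpIntegral.
Variable R : realType.
Local Notation mu := (@lebesgue_measure R).

Lemma is_derive_expRM (a t : R) :
  is_derive t 1 (fun t => expR (- (a * t))) (- a * expR (- (a * t))).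
Proof.
rewrite mulrC; apply: (@is_derive1_comp _ expR).
rewrite (_ : - a = - (a * 1)); last by rewrite mulr1.
apply: is_deriveN; apply: (@is_deriveZ _ _ _ id).
Qed.

Lemma continuous_expRM (a : R) : continuous (fun t => expR (- (a * t))).
Proof.
move=> t; apply/differentiable_continuous/derivable1_diffP.
by have [] := is_derive_expRM a t.
Qed.

Lemma integral_expRM (a : R) : 0 < a ->
  (\int[mu]_(t in `[0%R, +oo[) (expR (- (a * t)))%:E = (a^-1)%:E)%E.
Proof.
move=> a0.
have dF (t : R) : is_derive t 1 (fun t => - a^-1 * expR (- (a * t))) (expR (- (a * t))).
  rewrite (_ : expR (- (a * t)) = - a^-1 *: (- a * expR (- (a * t)))).
    exact: (is_deriveZ _ (is_derive_expRM a t)).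
  by rewrite -[RHS]/(_ * _); field; rewrite gt_eqF.
rewrite (@ge0_continuous_FTC2y _ _ (fun t => - a^-1 * expR (- (a * t))) _ 0)//.
- by rewrite mulr0 oppr0 expR0 mulr1 EFinN oppeK add0e.
- by apply: continuous_subspaceT; exact: continuous_expRM.
- rewrite -(mulr0 (- a^-1)); apply: cvgM; first exact: cvg_cst.
  apply: (@cvg_comp _ _ _ (fun t => a * t) (fun t => expR (- t)) _ (pinfty_nbhs R)).
    exact: gt0_cvgMry.
  exact: cvgr_expR.
- apply: cvg_at_right_filter; apply: cvgM; first exact: cvg_cst.
  exact: continuous_expRM.
- by move=> t _; rewrite derive1E; have [] := dF t.
Qed.

Lemma integrable_expRM (a : R) : 0 < a ->
  mu.-integrable `[0%R, +oo[ (EFin \o (fun t => expR (- (a * t)))).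
Proof.
move=> a0; apply/integrableP; split.
  apply/measurable_EFinP; apply: measurable_funTS.
  apply: continuous_measurable_fun; exact: continuous_expRM.
under eq_integral do rewrite /= ger0_norm ?expR_ge0//.
by rewrite integral_expRM// ltry.
Qed.

Lemma integrable_sum_expRM N (a f : nat -> R) : (forall k, 0 < f k) ->
  mu.-integrable `[0%R, +oo[ (EFin \o (fun t => \sum_(k < N) a k * expR (- (f k * t)))).
Proof.
move=> f0.
rewrite (_ : _ \o _ = fun t => (\sum_(k < N) (a k)%:E * (expR (- (f k * t)))%:E)%E).
  apply: integrable_sum => // k _; apply: integrableZl => //.
  exact: integrable_expRM.
by apply/funext => t; rewrite /= -sumEFin; apply: eq_bigr.
Qed.

Lemma Rintegral_sum_expRM N (a f : nat -> R) : (forall k, 0 < f k) ->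
  \int[mu]_(t in `[0%R, +oo[) (\sum_(k < N) a k * expR (- (f k * t))) =
  \sum_(k < N) a k / f k.
Proof.
move=> f0; elim: N => [|N IH].
  rewrite big_ord0 /Rintegral integral0_eq// => t _.
  by rewrite big_ord0.
rewrite big_ord_recr /= -IH.
transitivity (\int[mu]_(t in `[0%R, +oo[)
    (\sum_(k < N) a k * expR (- (f k * t)) + a N * expR (- (f N * t)))).
  by apply: eq_Rintegral => t _; rewrite big_ord_recr.
rewrite RintegralD//.
- rewrite RintegralZl//; last exact: integrable_expRM.
  by congr (_ + _ * _); rewrite /Rintegral integral_expRM.
- exact: integrable_sum_expRM.
- exact: (integrableZl _ (a N) (integrable_expRM (f0 N))).
Qed.

End ExpIntegral.

(** * Exponential sums *)

Section ExpSums.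
Variable R : realType.
Local Notation C := (Cx R).
Local Notation normc := (@ComplexField.Normc.normc R : C -> R).

(** Chosen so that [expC (ifreq k * z)] is q^(k + 1/6), the general exponent in the expansion of
    eta^4. *)
Definition freq (k : nat) : R := 2 * pi * (k%:R + 6^-1).
Definition ifreq (k : nat) : C := Complex 0 (freq k).
Definition expsum N (c : nat -> C) (z : C) : C :=
  \sum_(k < N) c k * expC (ifreq k * z).

Lemma freq_gt0 k : 0 < freq k.
Proof. by rewrite !mulr_gt0 ?pi_gt0// ltr_wpDl. Qed.

Lemma ifreqE k : ifreq k = twopii R * (k%:R + 6^-1).
Proof.
have -> : k%:R + 6^-1 = (k%:R + 6^-1 : R)%:C%C.
  by rewrite [RHS](rmorphD (real_complex R)) fmorphV !rmorph_nat.
by apply/eqP; rewrite eq_complex /= !(mul0r, mulr0, add0r, addr0, subr0, sub0r, oppr0) !eqxx.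
Qed.

Lemma Re_ifreqM k (z : C) : complex.Re (ifreq k * z) = - (freq k * complex.Im z).
Proof. by case: z => x y /=; rewrite mul0r sub0r. Qed.

Lemma normc_ifreq k : normc (ifreq k) = freq k.
Proof. by rewrite /= expr0n add0r sqrtr_sqr gtr0_norm ?freq_gt0. Qed.

Lemma expC_ifreqD k (z : C) t : expC (ifreq k * (z + Complex 0 t)) =
  expC (ifreq k * z) * (expR (- (freq k * t)))%:C%C.
Proof.
rewrite mulrDr expCD -expC_real; congr (_ * expC _).
by apply/eqP; rewrite eq_complex /= !(mul0r, mulr0, add0r, addr0, subr0, sub0r, oppr0) !eqxx.
Qed.

(** Separates the modulus of q^(k + 1/6) into the k-th power of the modulus of q and a factor common
    to all [k], so that sums over [k] become values of the majorant polynomial. *)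
Lemma expR_freq_le k (y : R) : expR (- (freq k * y)) =
  expR (- (2 * pi * y)) ^+ k * expR (- (pi / 3 * y)).
Proof. by rewrite -expRM_natl -expRD /freq; congr expR; field. Qed.

Section Majorized.
Variables (P : {poly R}) (c : nat -> C).
Hypothesis Pc : forall k, normc (c k) <= P`_k.

Let P0 k : 0 <= P`_k.
Proof. by apply: le_trans (Pc k); exact: normc_ge0. Qed.

Lemma expsum_le (z : C) : normc (expsum (size P) c z) <=
  P.[expR (- (2 * pi * complex.Im z))] * expR (- (pi / 3 * complex.Im z)).
Proof.
apply: le_trans (normc_sum _ _ _) _; rewrite horner_coef mulr_suml.
apply: ler_sum => k _; rewrite normcM normc_expC Re_ifreqM expR_freq_le mulrA.
by rewrite ler_wpM2r ?expR_ge0// ler_wpM2r ?exprn_ge0 ?expR_ge0.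
Qed.

(** Apply [x ^+ 2 / 2 <= exp x] to [x = freq k * y / 4]: the polynomial growth of the second
    derivative costs a quarter of the exponential decay. *)
Lemma sqr_freq_le k (y : R) : 0 < y ->
  freq k ^+ 2 <= 32 / y ^+ 2 * expR (freq k * y / 4).
Proof.
move=> y0; have f0 := freq_gt0 k.
have x0 : 0 <= freq k * y / 4 by apply: divr_ge0 => //; apply: mulr_ge0; exact: ltW.
have := expR_ge1Dxn 1 x0; rewrite (_ : 2`! = 2%N)// => H.
have -> : freq k ^+ 2 = 32 / y ^+ 2 * ((freq k * y / 4) ^+ 2 / 2).
  by field; rewrite gt_eqF.
rewrite ler_pM2l ?divr_gt0 ?exprn_gt0//; lra.
Qed.

(** Term by term, with [f = freq k], the decay [exp (- f y)] pays [exp (f y / 2)] for the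
    displacement [h < y / 2] and [exp (f y / 4)] for [f ^+ 2]. What remains is the decay at height
    [y / 4], and 128 is [4 * 32]. *)
Lemma expsum_quad (z w : C) (y := complex.Im z) : 0 < y -> normc (w - z) < y / 2 ->
  normc (expsum (size P) c w - expsum (size P) c z -
    expsum (size P) (fun k => c k * ifreq k) z * (w - z)) <=
  128 / y ^+ 2 * P.[expR (- (2 * pi * (y / 4)))] * normc (w - z) ^+ 2.
Proof.
move=> y0 wz; set h := normc (w - z) in wz *.
have h0 : 0 <= h := normc_ge0 _.
rewrite /expsum mulr_suml -!sumrB; apply: le_trans (normc_sum _ _ _) _.
rewrite horner_coef mulr_sumr mulr_suml; apply: ler_sum => k _.
have -> : c k * expC (ifreq k * w) - c k * expC (ifreq k * z) -
    c k * ifreq k * expC (ifreq k * z) * (w - z) =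
  c k * (expC (ifreq k * z) * (expC (ifreq k * (w - z)) - 1 - ifreq k * (w - z))).
  rewrite (_ : ifreq k * w = ifreq k * z + ifreq k * (w - z)); last by ring.
  by rewrite expCD; ring.
rewrite normcM [X in _ * X]normcM normc_expC Re_ifreqM -/y.
set B := (X in _ <= X).
have -> : B = P`_k * (128 / y ^+ 2 * expR (- (2 * pi * (y / 4))) ^+ k * h ^+ 2).
  by rewrite /B; ring.
apply: ler_pM; rewrite ?mulr_ge0 ?expR_ge0 ?normc_ge0//.
have := expC_quad (ifreq k * (w - z)); rewrite normcM normc_ifreq -/h => Hq.
apply: le_trans (ler_wpM2l (expR_ge0 _) Hq) _.
set f := freq k; have f0 : 0 < f := freq_gt0 k.
have fh : expR (f * h) <= expR (f * y / 2).
  by rewrite ler_expR -mulrA ler_wpM2l// ltW.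
apply: (@le_trans _ _ (expR (- (f * y)) * (4 * (f * h) ^+ 2 * expR (f * y / 2)))).
  by rewrite ler_wpM2l ?expR_ge0// ler_wpM2l// mulr_ge0 ?sqr_ge0.
have f2 := sqr_freq_le k y0; rewrite -/f in f2.
apply: (@le_trans _ _ (4 * h ^+ 2 * (expR (- (f * y)) * expR (f * y / 2)) *
   (32 / y ^+ 2 * expR (f * y / 4)))).
  apply: le_trans (_ : _ <= 4 * h ^+ 2 * (expR (- (f * y)) * expR (f * y / 2)) * f ^+ 2) _.
    by rewrite le_eqVlt; apply/orP; left; apply/eqP; ring.
  by rewrite ler_wpM2l// !mulr_ge0 ?expR_ge0.
have -> : 4 * h ^+ 2 * (expR (- (f * y)) * expR (f * y / 2)) *
   (32 / y ^+ 2 * expR (f * y / 4)) =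
   128 / y ^+ 2 * h ^+ 2 * expR (- (f * (y / 4))).
  rewrite -expRD [LHS](_ : _ = 128 / y ^+ 2 * h ^+ 2 *
    (expR (- (f * y) + f * y / 2) * expR (f * y / 4))); last by ring.
  by rewrite -expRD; congr (_ * expR _); field.
(* The factor coming from the shift 1/6 is at most 1 and is discarded. *)
rewrite expR_freq_le [leRHS]mulrAC; apply: ler_wpM2l.
  by apply: mulr_ge0; rewrite ?divr_ge0 ?sqr_ge0.
rewrite ler_piMr ?exprn_ge0 ?expR_ge0// -expR0 ler_expR oppr_le0.
by apply: mulr_ge0; [rewrite divr_ge0 ?pi_ge0|rewrite divr_ge0 ?ltW].
Qed.
End Majorized.
End ExpSums.

(** * The functions eta^4 and Z *)

Section EtaFunction.
Variable R : realType.
Local Notation C := (Cx R).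
Local Notation normc := (@ComplexField.Normc.normc R : C -> R).
Local Notation mu := (@lebesgue_measure R).

Lemma ReD (z w : C) : complex.Re (z + w) = complex.Re z + complex.Re w.
Proof. by case: z w => x y [u v]. Qed.
Lemma ImD (z w : C) : complex.Im (z + w) = complex.Im z + complex.Im w.
Proof. by case: z w => x y [u v]. Qed.
Lemma Re_sum N (f : 'I_N -> C) :
  complex.Re (\sum_(k < N) f k) = \sum_(k < N) complex.Re (f k).
Proof. by apply: (big_morph (@complex.Re R : C -> R) ReD). Qed.
Lemma Im_sum N (f : 'I_N -> C) :
  complex.Im (\sum_(k < N) f k) = \sum_(k < N) complex.Im (f k).
Proof. by apply: (big_morph (@complex.Im R : C -> R) ImD). Qed.
Lemma ReMr (z : C) (x : R) : complex.Re (z * x%:C%C) = complex.Re z * x.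
Proof. by case: z => u v /=; rewrite mulr0 subr0. Qed.
Lemma ImMr (z : C) (x : R) : complex.Im (z * x%:C%C) = complex.Im z * x.
Proof. by case: z => u v /=; rewrite mulr0 add0r. Qed.

Lemma Re_expsum_ray N c (z : C) t : complex.Re (expsum N c (z + Complex 0 t)) =
  \sum_(k < N) complex.Re (c k * expC (ifreq R k * z)) * expR (- (freq R k * t)).
Proof.
rewrite /expsum Re_sum; apply: eq_bigr => k _.
by rewrite expC_ifreqD mulrA ReMr.
Qed.
Lemma Im_expsum_ray N c (z : C) t : complex.Im (expsum N c (z + Complex 0 t)) =
  \sum_(k < N) complex.Im (c k * expC (ifreq R k * z)) * expR (- (freq R k * t)).
Proof.
rewrite /expsum Im_sum; apply: eq_bigr => k _.
by rewrite expC_ifreqD mulrA ImMr.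
Qed.

(** Moving up the ray by [t] multiplies the k-th term by [exp (- freq k * t)], whose integral is
    [1 / freq k]. *)
Lemma Cintegral_expsum N c (z : C) :
  Cintegral `[0%R, +oo[ (fun t => expsum N c (z + Complex 0 t)) =
  \sum_(k < N) c k * expC (ifreq R k * z) * (freq R k)^-1%:C%C.
Proof.
apply/eqP; rewrite eq_complex; apply/andP; split; apply/eqP.
  rewrite Re_sum; under [RHS]eq_bigr do rewrite ReMr.
  rewrite -(Rintegral_sum_expRM _
    (fun k => complex.Re (c k * expC (ifreq R k * z))) (@freq_gt0 R)).
  by apply: eq_Rintegral => t _; exact: Re_expsum_ray.
rewrite Im_sum; under [RHS]eq_bigr do rewrite ImMr.
rewrite -(Rintegral_sum_expRM _
    (fun k => complex.Im (c k * expC (ifreq R k * z))) (@freq_gt0 R)).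
by apply: eq_Rintegral => t _; exact: Im_expsum_ray.
Qed.

(** The n-th partial product of eta^4, expanded into exponentials. Summing up to the size of the
    majorant only adds zero terms and fits the estimates for dominated coefficients. *)
Definition etasum n : C -> C :=
  expsum (size (majorant_poly R n)) (fun k => (euler_poly R n)`_k).
(* The derivative of [Zsum n] is [2 pi i / 6] times [etasum n]:
   [(2 pi i / 6) / (2 pi i (k + 1/6)) = 1 / (6 k + 1)]. *)
Definition Zsum n : C -> C := expsum (size (majorant_poly R n))
  (fun k => (euler_poly R n)`_k * ((6 * k%:R + 1)^-1 : R)%:C%C).

Lemma etasumE n z : etasum n z =
  expC (twopii R * z / 6) * (euler_poly R n).[expC (twopii R * z)].
Proof.
rewrite (@horner_coef_wide _ (size (majorant_poly R n))); last first.
  exact: majorizes_size (@euler_poly_majorized R n).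
rewrite mulr_sumr; apply: eq_bigr => k _.
rewrite [RHS]mulrCA -expCMn -expCD; congr (_ * expC _).
by rewrite ifreqE; field.
Qed.

Lemma extend_uhp (f : uhp R -> C) (w : C) (w0 : 0 < complex.Im w) :
  extend f w = f (Uhp w0).
Proof. by rewrite -(extendE f (Uhp w0)). Qed.

Lemma normc_q (z : C) : normc (expC (twopii R * z)) = expR (- (2 * pi * complex.Im z)).
Proof. by rewrite normc_expC; case: z => x y /=; rewrite mul0r sub0r. Qed.

Lemma expR_q_lt1 (y : R) : 0 < y -> 0 <= expR (- (2 * pi * y)) < 1.
Proof.
by move=> y0; rewrite expR_ge0 expR_lt1 oppr_lt0 !mulr_gt0 ?pi_gt0.
Qed.

Lemma normc_q_lt1 (z : C) : 0 < complex.Im z -> normc (expC (twopii R * z)) < 1.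
Proof. by move=> /expR_q_lt1/andP[_]; rewrite normc_q. Qed.

Lemma etasum_cvg (z : C) : 0 < complex.Im z ->
  etasum n z @[n --> \oo] --> extend (@eta4 R) z.
Proof.
move=> z0; rewrite extend_uhp /eta4 /eta /=; set q := expC (twopii R * z).
have q1 : normc q < 1 by exact: normc_q_lt1.
rewrite exprMn -expCMn (_ : 4%:R * (twopii R * z / 24) = twopii R * z / 6); last by field.
have -> : etasum ^~ z = fun n => expC (twopii R * z / 6) *
    ((\prod_(1 <= m < n.+1) (1 - q ^+ m)) ^+ 4 : C).
  apply/funext => n; rewrite etasumE horner_exp horner_prod.
  by under eq_bigr do rewrite hornerD hornerN hornerC hornerXn.
apply: cvgM; first exact: cvg_cst.
have H : (fun n => \prod_(1 <= m < n.+1) (1 - q ^+ m) : C) @ \oo --> _ :=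
  euler_prod_cvg q1.
rewrite !exprS expr0 mulr1; under eq_fun do rewrite !exprS expr0 mulr1.
by do 3![apply: cvgM; first exact: H].
Qed.

Lemma eta4_neq0 (z : uhp R) : eta4 z != 0.
Proof.
rewrite expf_eq0/= /eta mulf_neq0 ?expC_neq0//.
exact/euler_prod_lim_neq0/normc_q_lt1/uhpP.
Qed.

(** The modulus of q decreases with the height and [r / (1 - r)] increases with [r], so the bound at
    height [y] holds all along the vertical ray, for every [n]. *)
Lemma majorant_poly_expR n (y t : R) : 0 < y -> 0 <= t ->
  (majorant_poly R n).[expR (- (2 * pi * (y + t)))] <=
  expR (expR (- (2 * pi * y)) / (1 - expR (- (2 * pi * y)))) ^+ 4.
Proof.
move=> y0 t0; have yt : 0 < y + t by rewrite ltr_wpDr.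
have r1 := expR_q_lt1 y0; have r2 := expR_q_lt1 yt.
apply: le_trans (majorant_poly_le n r2) _.
rewrite lerXn2r ?nnegrE ?expR_ge0// ler_expR.
have rr : expR (- (2 * pi * (y + t))) <= expR (- (2 * pi * y)).
  by rewrite ler_expR lerN2 ler_wpM2l ?mulr_ge0 ?pi_ge0// lerDl.
move: r1 r2 => /andP[a0 a1] /andP[b0 b1].
apply: ler_pM => //; first by rewrite invr_ge0 subr_ge0 ltW.
by rewrite lef_pV2 ?posrE ?subr_gt0// lerD2l lerN2.
Qed.

Lemma near_ball_Im (z w : C) : 0 < complex.Im z -> normc (w - z) < complex.Im z / 2 ->
  0 < complex.Im w.
Proof.
move=> z0; move/(le_lt_trans (Im_le_normc _)); rewrite ImB => wz.
have := ler_norm (- (complex.Im w - complex.Im z)); rewrite normrN; lra.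
Qed.

Definition quad_bound (y : R) : R :=
  let e := expR (- (2 * pi * (y / 4))) in 128 / y ^+ 2 * expR (e / (1 - e)) ^+ 4.

(** Makes the constant of [expsum_quad] independent of [n], as [quad_cvg] demands; it serves both
    [etasum] and [Zsum]. *)
Lemma expsum_family_quad (c : nat -> nat -> C) (z w : C) n :
  (forall n k, normc (c n k) <= (majorant_poly R n)`_k) ->
  0 < complex.Im z -> normc (w - z) < complex.Im z / 2 ->
  normc (expsum (size (majorant_poly R n)) (c n) w -
    expsum (size (majorant_poly R n)) (c n) z -
    expsum (size (majorant_poly R n)) (fun k => c n k * ifreq R k) z * (w - z)) <=
  quad_bound (complex.Im z) * normc (w - z) ^+ 2.
Proof.
move=> cP z0 wz; apply: le_trans (expsum_quad (cP n) z0 wz) _.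
rewrite ler_wpM2r ?sqr_ge0// ler_wpM2l ?divr_ge0 ?sqr_ge0//.
by have := @majorant_poly_expR n (complex.Im z / 4) 0; rewrite addr0 divr_gt0//; exact.
Qed.

Lemma holomorphic_eta4 : holomorphic (@eta4 R).
Proof.
move=> z; have z0 := uhpP z.
have [|w wz|l _ []//] := @quad_cvg R etasum (extend (@eta4 R))
    (fun n => expsum (size (majorant_poly R n))
      (fun k => (euler_poly R n)`_k * ifreq R k) (uhp_val z))
    (uhp_val z) (quad_bound (complex.Im (uhp_val z))) _ (divr_gt0 z0 (ltr0Sn _ 1)).
  move=> n w; apply: (@expsum_family_quad (fun n k => (euler_poly R n)`_k) _ w n) => // {}n k.
  exact: euler_poly_majorized.
by apply: etasum_cvg; exact: near_ball_Im z0 wz.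
Qed.

Lemma twopii6E : twopii R / 6 = Complex 0 (pi / 3).
Proof.
have -> : 6^-1 = (6^-1 : R)%:C%C by rewrite fmorphV rmorph_nat.
apply/eqP; rewrite eq_complex /= !(mul0r, mulr0, add0r, addr0, subr0, oppr0) eqxx /=.
by apply/eqP; field.
Qed.

(** Matches the value [1 / freq k] of the ray integral, times the prefactors of [Zint], with the
    coefficients of [Zsum]. *)
Lemma divr_freq k : ((6 * k%:R + 1)^-1)%:C%C =
  twopii R / 6 * - (Complex 0 1 * (freq R k)^-1%:C%C).
Proof.
rewrite twopii6E; apply/eqP; rewrite eq_complex /=.
rewrite !(mul0r, mulr0, mul1r, add0r, addr0, subr0, sub0r, oppr0, opprK, mulrN) eqxx andbT.
apply/eqP; rewrite /freq; field.
have := ler0n R k; have := pi_gt0 R => p0 k0.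
by do ?[apply/andP; split]; apply: lt0r_neq0 => //; lra.
Qed.

(** [Zsum n] is exactly the formula of [Zint] with [etasum n] in place of eta^4, since finite sums
    integrate termwise. Dominated convergence on the ray then gives the limit. *)
Lemma Zsum_cvg (z : uhp R) : Zsum n (uhp_val z) @[n --> \oo] --> Zint z.
Proof.
have z0 := uhpP z; set y := complex.Im (uhp_val z) in z0.
have ZsumE n : Zsum n (uhp_val z) = twopii R / 6 *
  - (Complex 0 1 * Cintegral `[0%R, +oo[ (fun t => etasum n (uhp_val z + Complex 0 t))).
  rewrite Cintegral_expsum mulr_sumr -sumrN mulr_sumr; apply: eq_bigr => k _.
  by rewrite mulrAC divr_freq; ring.
under eq_fun do rewrite ZsumE.
apply: cvgM; first exact: cvg_cst.
apply: cvgN; apply: cvgM; first exact: cvg_cst.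
have ray t : 0 <= t -> complex.Im (uhp_val z + Complex 0 t) = y + t.
  by move=> t0; rewrite ImD.
(* [M] bounds the majorants on the whole ray; the integrable decay of [g] is that of q^(1/6). *)
pose M : R := expR (expR (- (2 * pi * y)) / (1 - expR (- (2 * pi * y)))) ^+ 4.
pose g t := M * expR (- (pi / 3 * t)).
have ig : mu.-integrable `[0%R, +oo[ (EFin \o g).
  apply: (integrableZl _ M (integrable_expRM _)) => //.
  by rewrite divr_gt0// pi_gt0.
have dom n t : 0 <= t -> normc (etasum n (uhp_val z + Complex 0 t)) <= g t.
  move=> t0; apply: le_trans (expsum_le _ _) _; first exact: euler_poly_majorized.
  rewrite ray//; apply: ler_pM; rewrite ?expR_ge0//.
  - rewrite horner_coef sumr_ge0// => k _; rewrite mulr_ge0 ?exprn_ge0 ?expR_ge0//.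
    exact: majorizes_ge0 (@euler_poly_majorized R n).
  - exact: majorant_poly_expR.
  by rewrite ler_expR lerN2 ler_wpM2l ?divr_ge0 ?pi_ge0// lerDr ltW.
have lim t : 0 <= t -> etasum n (uhp_val z + Complex 0 t) @[n --> \oo] -->
    extend (@eta4 R) (uhp_val z + Complex 0 t).
  by move=> t0; apply: etasum_cvg; rewrite ray// ltr_wpDr.

(* [p] stands for the real or the imaginary part, which are treated at once. *)
have intRI (p : C -> R) : (forall w, `|p w| <= normc w) ->
   (forall (u : nat -> C) l, u @ \oo --> l -> p (u n) @[n --> \oo] --> p l) ->
   (forall n, mu.-integrable `[0%R, +oo[
      (EFin \o (fun t => p (etasum n (uhp_val z + Complex 0 t))))) ->
  \int[mu]_(t in `[0%R, +oo[) p (etasum n (uhp_val z + Complex 0 t)) @[n --> \oo] -->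
  \int[mu]_(t in `[0%R, +oo[) p (extend (@eta4 R) (uhp_val z + Complex 0 t)).
  move=> pn pc pm.
  pose f_ n t := (p (etasum n (uhp_val z + Complex 0 t)))%:E.
  pose f t := (p (extend (@eta4 R) (uhp_val z + Complex 0 t)))%:E.
  have mf n := measurable_int mu (pm n).
  have ff (t : R) : `[0%R, +oo[%classic t -> f_ n t @[n --> \oo] --> f t.
    rewrite /= in_itv /= andbT => t0; apply: cvg_EFin; first exact: nearW.
    exact/pc/lim.
  have fg n (t : R) : `[0%R, +oo[%classic t -> (`|f_ n t| <= (EFin \o g) t)%E.
    rewrite /= in_itv /= andbT => t0.
    by rewrite lee_fin; apply: le_trans (pn _) _; exact: dom.
  (* Dominated convergence concerns extended real integrals; returning to [R] requires a finite
     limit, which domination by [g] provides again. *)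
  apply: fine_cvg; rewrite fineK.
    by apply: (@dominated_cvg _ _ _ mu `[0%R, +oo[ _ f_ f (EFin \o g)).
  apply: integrable_fin_num => //.
  apply: le_integrable ig => //; first exact: emeasurable_fun_cvg mf ff.
  move=> t; rewrite /= in_itv /= andbT => t0; rewrite lee_fin.
  rewrite [leRHS]ger0_norm ?mulr_ge0 ?exprn_ge0 ?expR_ge0//.
  apply: le_trans (pn _) _; apply: cvg_norm_le (lim t t0) _ => n; exact: dom.
apply/cvgC_ReImP; split; apply: intRI.
- exact: Re_le_normc.
- by move=> u l /cvgC_ReImP[].
- move=> n; rewrite (funext (Re_expsum_ray _ _ _)).
  exact: (integrable_sum_expRM _
    (fun k => complex.Re ((euler_poly R n)`_k * expC (ifreq R k * uhp_val z)))
    (@freq_gt0 R)).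
- exact: Im_le_normc.
- by move=> u l /cvgC_ReImP[].
move=> n; rewrite (funext (Im_expsum_ray _ _ _)).
exact: (integrable_sum_expRM _
    (fun k => complex.Im ((euler_poly R n)`_k * expC (ifreq R k * uhp_val z)))
    (@freq_gt0 R)).
Qed.

Lemma is_derive_Zint (z : uhp R) :
  is_derive (uhp_val z) 1 (extend (@Zint R)) (twopii R / 6 * eta4 z).
Proof.
have z0 := uhpP z.
pose c n k := (euler_poly R n)`_k * ((6 * k%:R + 1)^-1 : R)%:C%C.
pose a n :=
  expsum (size (majorant_poly R n)) (fun k => c n k * ifreq R k) (uhp_val z).
have [n w||l al dl] := @quad_cvg R Zsum (extend (@Zint R)) a
    (uhp_val z) (quad_bound (complex.Im (uhp_val z))) _ (divr_gt0 z0 (ltr0Sn _ 1)).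
- apply: (@expsum_family_quad c _ w n) => // {}n k.
  rewrite normcM normcR; apply: le_trans (_ : _ <= normc (euler_poly R n)`_k) _.
    rewrite ler_piMr ?normc_ge0// ger0_norm ?invr_ge0 ?addr_ge0// ?mulr_ge0//.
    by rewrite invf_le1 ?lerDr ?mulr_ge0// ltr_wpDl// mulr_ge0.
  exact: euler_poly_majorized.
- move=> w /(near_ball_Im z0) w0; rewrite (extend_uhp _ w0).
  exact: (@Zsum_cvg (Uhp w0)).
(* [quad_cvg] yields the derivative as the limit of the slopes [a n]. Multiplying by [ifreq k]
   undoes the termwise integration, so these slopes are [twopii R / 6 * etasum n], whose limit is
   known. *)
suff <- : l = twopii R / 6 * eta4 z by [].
have aE : a = fun n => twopii R / 6 * etasum n (uhp_val z).
  apply/funext => n; rewrite /a /c /etasum /expsum mulr_sumr; apply: eq_bigr => k _.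
  rewrite divr_freq; set u := - _.
  have uf : u * ifreq R k = 1.
    have fk : freq R k != 0 by rewrite gt_eqF ?freq_gt0.
    apply/eqP; rewrite eq_complex /=.
    rewrite !(mul0r, mulr0, mul1r, add0r, addr0, sub0r, oppr0, mulNr, opprK).
    by rewrite mulVf// !eqxx.
  by rewrite -[in RHS](mulr1 (twopii R / 6)) -uf; ring.
have cl : a @ \oo --> twopii R / 6 * eta4 z.
  rewrite aE -(extendE (@eta4 R) z); apply: cvgM; first exact: cvg_cst.
  exact: etasum_cvg.
exact: norm_cvg_unique al cl.
Qed.
End EtaFunction.

(** * Logarithmic derivatives and d/dZ *)

Section Calculus.
Variable R : realType.
Local Notation C := (Cx R).
Local Notation hfun := (uhp R -> C).

Lemma linear_scalarE (K : numFieldType) (l : {linear K^o -> K^o}) (c : K) :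
  l c = l 1 * c.
Proof. by rewrite -{1}(mulr1 c) -[c * 1]/(c *: (1 : K^o)) linearZ mulrC. Qed.

(** In dimension one a differential is multiplication by its value at 1, so composing differentials
    multiplies derivatives. *)
Lemma is_deriveC_comp (f g : C -> C) (x a b : C) :
  is_derive (g x) 1 f a -> is_derive x 1 g b -> is_derive x 1 (f \o g) (a * b).
Proof.
move=> [/derivable1_diffP df <-] [/derivable1_diffP dg <-].
have dfg := differentiable_comp dg df.
apply: DeriveDef; first exact/derivable1_diffP.
rewrite (deriveE (1:C) dfg).
rewrite (deriveE (1:C) df).
rewrite (deriveE (1:C) dg).
have E := congr1 (fun h => h (1 : C)) (diff_comp dg df).
etransitivity; first exact: E.
exact (linear_scalarE ('d f (g x)) ('d g x 1)).
Qed.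

Lemma is_deriveC_inv (f : C -> C) (x a : C) : f x != 0 ->
  is_derive x 1 f a -> is_derive x 1 (fun y => (f y)^-1) (- a / f x ^+ 2).
Proof.
move=> fx0 [df <-]; apply: DeriveDef; first exact: derivableV.
by rewrite deriveV// -[LHS]/(_ * _) mulNr mulrC mulNr.
Qed.

(** Differentiation is local and both [U] and the half-plane are open: values of the extension by 0
    outside them do not matter. *)
Lemma is_derive_extend (U : set C) (f : hfun) (F : C -> C) (z : uhp R) (a : C) :
    open U -> U (uhp_val z) ->
    (forall w : uhp R, U (uhp_val w) -> f w = F (uhp_val w)) ->
  is_derive (uhp_val z) 1 F a -> is_derive (uhp_val z) 1 (extend f) a.
Proof.
move=> Uo Uz fF; apply: near_eq_is_derive.
have Un : \forall w \near uhp_val z, U w by exact: open_nbhs_nbhs.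
apply: filterS2 (near_uhp z) Un => w w0 Uw.
by rewrite (extend_uhp _ w0) (fF (Uhp w0)).
Qed.

Lemma is_derive_ddz (f : hfun) (z : uhp R) : derivable (extend f) (uhp_val z) 1 ->
  is_derive (uhp_val z) 1 (extend f) (ddz f z).
Proof. exact: derivableP. Qed.

Lemma ddzM (f g : hfun) z : holomorphic f -> holomorphic g ->
  ddz (f * g) z = ddz f z * g z + f z * ddz g z.
Proof.
move=> hf hg; rewrite /ddz.
have H : is_derive (uhp_val z) 1 (extend f * extend g)
  (extend f (uhp_val z) *: ddz g z + extend g (uhp_val z) *: ddz f z).
  by apply: is_deriveM; exact: is_derive_ddz.
have fgE (w : uhp R) : setT (uhp_val w) -> (f * g) w = (extend f * extend g) (uhp_val w).
  by move=> _; rewrite !fctE !extendE.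
have [_ ->] := is_derive_extend openT I fgE H.
by rewrite !extendE addrC; congr (_ + _); exact: mulrC.
Qed.

Lemma is_derive_affine (a b z : C) : is_derive z 1 (fun w => a * w + b) a.
Proof.
rewrite -[X in is_derive _ _ _ X]addr0; apply: is_deriveD.
rewrite -[X in is_derive _ _ _ X]mulr1; exact: is_deriveZ.
Qed.

Lemma is_derive_mobius (g : GL2pQ) (z : uhp R) :
  is_derive (uhp_val z) 1 (fun w : C => gnum g w / gden g w)
    (ratr (\det g) / gden g (uhp_val z) ^+ 2).
Proof.
have dn := is_derive_affine (ratr (g 0 0)) (ratr (g 0 1)) (uhp_val z).
have dd := is_derive_affine (ratr (g 1 0)) (ratr (g 1 1)) (uhp_val z).
have dz := gden_neq0 g z.
have := is_deriveM dn (is_deriveC_inv dz dd).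
rewrite -!/(_ * _) => H.
rewrite (_ : _ / _ = (ratr (g 0 0) * uhp_val z + ratr (g 0 1)) *
     (- ratr (g 1 0) / gden g (uhp_val z) ^+ 2) +
   (gden g (uhp_val z))^-1 * ratr (g 0 0)); first exact: H.
rewrite det_mx2 rmorphB !rmorphM /=.
move: dz; rewrite /gden => dz; field.
exact: dz.
Qed.

(** In weight 2 the power of the determinant is 1, and the slash action becomes the pullback of the
    differential [f dz]. *)
Lemma slash2E g (f : hfun) z : slash 2 g f z =
  f (mobius g z) * (ratr (\det g) / gden g (uhp_val z) ^+ 2).
Proof.
rewrite /slash divff// powRr1 ?ler0q ?ltW ?gmxP// ratCE.
by rewrite mulrA [_ * f _]mulrC.
Qed.

Lemma ddz_Zint_mobius g z :
  ddz (fun w => Zint (mobius g w)) z = twopii R / 6 * slash 2 g (@eta4 R) z.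
Proof.
have := is_derive_mobius g z; have := is_derive_Zint (mobius g z).
move=> H1 H2; have H := @is_deriveC_comp _ (fun w : C => gnum g w / gden g w) _ _ _ H1 H2.
have ZE (w : uhp R) : setT (uhp_val w) -> Zint (mobius g w) =
    (extend (@Zint R) \o (fun w : C => gnum g w / gden g w)) (uhp_val w).
  by move=> _; rewrite -(extendE (@Zint R)).
by have [_] := is_derive_extend openT I ZE H; rewrite /ddz => ->; rewrite slash2E mulrA.
Qed.

Lemma twopii_neq0 : twopii R != 0.
Proof. by rewrite eq_complex /= eqxx /= gt_eqF// mulr_gt0 ?pi_gt0. Qed.

(** The factors [twopii / 6] cancel. This identifies the quotient whose logarithmic derivative
    defines [mu] with d(Z|g)/dZ. *)
Lemma ddZ_Zint_mobius g z :
  ddZ (fun w => Zint (mobius g w)) z = slash 2 g (@eta4 R) z / eta4 z.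
Proof.
rewrite /ddZ ddz_Zint_mobius; have := twopii_neq0; have := eta4_neq0 z.
by move=> e0 t0; field; rewrite e0 t0.
Qed.

(** Differentiate [expC L = F] on [U]; the result no longer depends on the branch. *)
Lemma ddz_log_branch U (F L : hfun) (z : uhp R) : log_branch U F L ->
  U (uhp_val z) -> ddz L z = dlog F z.
Proof.
move=> [Uo UL] Uz; have [dL LF] := UL _ Uz.
have H := @is_deriveC_comp _ _ _ _ _ (is_derive_expC _) (is_derive_ddz dL).
have FE (w : uhp R) : U (uhp_val w) -> F w = (@expC R \o extend L) (uhp_val w).
  by move=> /UL[_ <-]; rewrite /= extendE.
have [_] := is_derive_extend Uo Uz FE H; rewrite extendE LF /dlog /ddz => ->.
by rewrite mulrAC divff ?mul1r// -LF expC_neq0.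
Qed.

(** The case [n = 1]: both sides are the coefficient of dz in the logarithmic differential of
    d(Z|g)/dZ, as dZ = (2 pi i / 6) eta^4 dz. *)
Lemma mu_log_branch U g (L : hfun) (z : uhp R) :
    log_branch U (ddZ (fun z => Zint (mobius g z))) L -> U (uhp_val z) ->
  mu g z * twopii R = ddZ L z * (twopii R / 6 * eta4 z).
Proof.
move=> UL Uz; rewrite /ddZ (ddz_log_branch UL Uz).
have -> : ddZ (fun z => Zint (mobius g z)) = fun w => slash 2 g (@eta4 R) w / eta4 w.
  by apply/funext => w; rewrite ddZ_Zint_mobius.
rewrite /mu; move: (dlog _ z) => d.
have := twopii_neq0; have := eta4_neq0 z => e0 t0; field; by rewrite e0 t0.
Qed.

(** The inductive step on the analytic side. The hypothesis says that [u] represents [D] times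
    (dZ)^N, that is [D = u (6 / eta^4)^N] on [U]. Differentiating the power produces [- N u] times
    the logarithmic derivative of eta^4, which is the correction term of [Xwt] in weight [2 * N]. *)
Lemma Xwt_ddZ (U : set C) N (u D : hfun) : open U -> holomorphic u ->
    (forall w : uhp R, U (uhp_val w) ->
      u w * twopii R ^+ N = D w * (twopii R / 6 * eta4 w) ^+ N) ->
  forall z : uhp R, U (uhp_val z) ->
    Xwt (2 * N) u z * twopii R ^+ N.+1 = ddZ D z * (twopii R / 6 * eta4 z) ^+ N.+1.
Proof.
move=> Uo hu HD z Uz; have e0 := eta4_neq0 z; have t0 := twopii_neq0.
have ez : extend (@eta4 R) (uhp_val z) != 0 by rewrite extendE.
have de := is_deriveC_inv ez (is_derive_ddz (@holomorphic_eta4 R z)).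
have := is_deriveM (is_derive_ddz (hu z)) (is_deriveX N (is_deriveZ 6 de)) => H.
have DE w : U (uhp_val w) -> D w =
   (extend u * (6 \*: (fun y => (extend (@eta4 R) y)^-1)) ^+ N) (uhp_val w).
  move=> Uw; have ew := eta4_neq0 w.
  rewrite !fctE /= !extendE -[_ *: _]/(_ * _).
  have sN : (twopii R / 6 * eta4 w) ^+ N != 0.
    apply: expf_neq0; apply: mulf_neq0; last exact: ew.
    by apply: mulf_neq0; [exact: t0|rewrite invr_eq0 pnatr_eq0].
  apply: (mulIf sN); rewrite -HD// -[RHS]mulrA -exprMn; congr (_ * _ ^+ _).
  by field.
have dD : ddz D z = u z *
    (N%:R * (6 / eta4 z) ^+ N.-1 * (6 * (- ddz (@eta4 R) z / eta4 z ^+ 2))) +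
    (6 / eta4 z) ^+ N * ddz u z.
  have [_] := is_derive_extend Uo Uz DE H; rewrite -/(ddz D z) => ->.
  by rewrite !fctE /= !extendE.
rewrite /ddZ dD /Xwt /Ywt /dlog natrM {dD H HD DE de ez}.
move: (ddz (@eta4 R) z) (ddz u z) (u z) (twopii R) (eta4 z) t0 e0 => d u' v t e t0 e0.
(* The derivative of the N-th power contains the exponent [N.-1], so [N = 0] is separate. *)
case: N => [|m] /=.
  by rewrite !expr0 expr1; field; rewrite e0 t0.
(* As [(6 / e) * (t / 6 * e) = t], all powers of variable exponent are expressed through two of
   them, which are then abstracted for [field]. *)
have -> : t ^+ m.+2 = (6 / e) ^+ m * (t / 6 * e) ^+ m * t ^+ 2.
  by rewrite -exprMn -addn2 exprD; congr (_ ^+ _ * _); field.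
rewrite !(exprS _ m.+1) !(exprS _ m).
move: ((6 / e) ^+ m) ((t / 6 * e) ^+ m) => A B.
by field; rewrite e0 t0.
Qed.
End Calculus.

(** * The action of delta_n *)

Section DeltaAction.
Variable R : realType.
Local Notation C := (Cx R).
Local Notation hfun := (uhp R -> C).

Lemma Xwt0 k : Xwt k (0 : hfun) = 0.
Proof.
apply/funext => z; rewrite /Xwt /Ywt !mulr0 subr0.
suff -> : ddz (0 : hfun) z = 0 by rewrite mulr0.
have E (w : uhp R) : setT (uhp_val w) -> (0 : hfun) w = (cst 0 : C -> C) (uhp_val w) by [].
have dc : is_derive (uhp_val z) 1 (cst 0 : C -> C) 0 by exact: is_derive_cst.
by have [_ H] := is_derive_extend openT I E dc.
Qed.

(** Both d/dz and multiplication by the weight are derivations, the latter because weights add. *)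
Lemma XwtM m k (f g : hfun) : holomorphic f -> holomorphic g ->
  Xwt (m + k) (f * g) = Xwt m f * g + f * Xwt k g.
Proof.
move=> hf hg; apply/funext => z.
rewrite /Xwt /Ywt /dlog ddzM// !fctE natrD.
move: (_ / eta4 z) (ddz f z) (ddz g z) (f z) (g z) => e f' g' a b.
by field; rewrite twopii_neq0.
Qed.

(** Splits X into its action on each component and the shift of weight by 2, so that identities can
    be checked coefficientwise; beyond the size of [p], [Xwt0] gives zero coefficients. *)
Lemma XmodE (p : {poly hfun}) : exists2 q : {poly hfun},
  forall k, q`_k = Xwt k p`_k & Xmod p = q * 'X^2.
Proof.
exists (\poly_(k < size p) Xwt k p`_k).
  by move=> k; rewrite coef_poly; case: ltnP => // sp; rewrite nth_default// Xwt0.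
rewrite poly_def mulr_suml; apply: eq_bigr => k _.
by rewrite exprD -scalerAl.
Qed.

Lemma Xmod_monomial (u : hfun) m : Xmod (u *: 'X^m) = Xwt m u *: 'X^(m + 2).
Proof.
have [q qE ->] := XmodE (u *: 'X^m).
rewrite exprD scalerAl; congr (_ * _); apply/polyP => k.
rewrite qE !coefZ coefXn; case: eqP => [->|_]; first by rewrite !mulr1.
by rewrite !mulr0 Xwt0.
Qed.

(** The Leibniz rule with one homogeneous factor, the only case required since each multiplier h_n
    is homogeneous. *)
Lemma XmodM (u : hfun) m (p : {poly hfun}) :
    holomorphic u -> (forall k, holomorphic p`_k) ->
  Xmod (u *: 'X^m * p) = Xmod (u *: 'X^m) * p + u *: 'X^m * Xmod p.
Proof.
move=> hu hp; rewrite Xmod_monomial.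
have [q qE ->] := XmodE (u *: 'X^m * p); have [r rE ->] := XmodE p.
rewrite exprD scalerAl [_ * p]mulrAC [_ * (r * _)]mulrA -mulrDl; congr (_ * _).
apply/polyP => k; rewrite qE coefD -!scalerAl !coefZ !coefXnM rE.
case: ltnP => km; first by rewrite !mulr0 Xwt0 addr0.
by have := XwtM m (k - m) hu (hp (k - m)%N); rewrite subnKC.
Qed.

Lemma modular_holo (f : modform R) k : holomorphic (mf_poly f)`_k.
Proof. by case: f => p /= /asboolP[N _ /(_ k)[]]. Qed.

End DeltaAction.

Theorem proposition8 (R : realType)
  (act : H1 (Cx R) -> crossed R -> crossed R)
  (act_hopf : hopf_action act)
  (act_X : forall (f : modform R) (g : GL2pQ),
     exists2 Xf : modform R, mf_poly Xf = Xmod (mf_poly f) &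
       act (hX (Cx R)) << f *g g >> = << Xf *g g >>)
  (act_Y : forall (f : modform R) (g : GL2pQ),
     exists2 Yf : modform R, mf_poly Yf = Ymod (mf_poly f) &
       act (hY (Cx R)) << f *g g >> = << Yf *g g >>)
  (act_delta1 : forall g : GL2pQ,
     exists2 m : modform R, mf_poly m = mu g *: 'X^2 &
       forall f : modform R,
         act (hdelta (Cx R) 1) << f *g g >> = << m * f *g g >>)
  (n : nat) (n_gt0 : (0 < n)%N) (g : GL2pQ) :
  exists h : modform R,
    [/\ weight (2 * n) h,
        forall f : modform R,
          act (hdelta (Cx R) n) << f *g g >> = << h * f *g g >> &
        forall (U : set (Cx R)) (L : uhp R -> Cx R),
          log_branch U (ddZ (fun z => Zint (mobius g z))) L ->
          forall z : uhp R, U (uhp_val z) ->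
            (mf_poly h)`_(2 * n) z * twopii R ^+ n =
            iter n (@ddZ R) L z * (twopii R / 6 * eta4 z) ^+ n].
Proof.
(* For the induction the multiplier is kept as a monomial, so that its component [u] can be fed to
   [Xwt]. *)
suff [h [u [hE hact hL]]] : exists (h : modform R) (u : uhp R -> Cx R),
    [/\ mf_poly h = u *: 'X^(2 * n),
        forall f : modform R,
          act (hdelta (Cx R) n) << f *g g >> = << h * f *g g >> &
        forall (U : set (Cx R)) (L : uhp R -> Cx R),
          log_branch U (ddZ (fun z => Zint (mobius g z))) L ->
          forall z : uhp R, U (uhp_val z) ->
            u z * twopii R ^+ n = iter n (@ddZ R) L z * (twopii R / 6 * eta4 z) ^+ n].
  exists h; split=> //.
    by move=> j /eqP/negPf jn; rewrite hE coefZ coefXn jn mulr0.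
  by move=> U L UL z Uz; rewrite hE coefZ coefXn eqxx mulr1; exact: hL UL _ Uz.
case: n n_gt0 => // {}n _; elim: n => [|n [h [u [hE hact hL]]]].
  have [m mE mact] := act_delta1 g; exists m, (mu g); split=> // U L UL z Uz.
  by rewrite !expr1; exact: mu_log_branch UL Uz.
have hu : holomorphic u.
  by have := @modular_holo R h (2 * n.+1); rewrite hE coefZ coefXn eqxx mulr1.
(* The next multiplier is X h; that it is again a modular form is part of [act_X]. *)
have [Xh XhE _] := act_X h g.
exists Xh, (Xwt (2 * n.+1) u).
have hXE : mf_poly Xh = Xwt (2 * n.+1) u *: 'X^(2 * n.+2).
  by rewrite XhE hE Xmod_monomial [(2 * n.+2)%N]mulnS addnC.
split=> //.
  (* The commutator of the derivation X with multiplication by [h] is multiplication by X h. *)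
  move=> f; rewrite -br_Xd /lie.
  have actB a b x : act (a - b) x = act a x - act b x.
    by have := act_addl act_hopf (a - b) b x; rewrite subrK => ->; rewrite addrK.
  rewrite actB !(act_mul act_hopf) hact.
  have [Xf XfE ->] := act_X f g; have [Xhf XhfE ->] := act_X (h * f) g.
  rewrite hact -monalgUB; congr << _ *g _ >>; apply/val_inj => /=.
  rewrite -[LHS]/(mf_poly Xhf - mf_poly h * mf_poly Xf).
  rewrite -[RHS]/(mf_poly Xh * mf_poly f) XhfE -[mf_poly (h * f)]/(mf_poly h * mf_poly f).
  by rewrite XfE XhE hE (XmodM _ hu (@modular_holo R f)) addrK.
move=> U L UL z Uz; rewrite iterS.
apply: Xwt_ddZ Uz => //; first exact: UL.1.
by move=> w Uw; exact: hL UL w Uw.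
Qed.
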